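(* The inclusion map $\Pi\ni\mathcal{P}\mapsto\mathcal{P}\in(\mathcal{F}(\mathcal{X},\square),\tau\mathrm{K})$ is a topological embedding, where $\Pi$ carries the weak topology.
   Context: An mm-space is a triple $(X,d_X,\mu_X)$ with $(X,d_X)$ complete separable metric and $\mu_X$ a Borel probability measure; mm-isomorphism means an isometry between supports pushing $\mu_X$ to $\mu_Y$; $\mathcal{X}$ is the set of mm-isomorphism classes. A parameter of $X$ is a Borel map $\varphi\colon I=[0,1)\to X$ with $\varphi_*\mathcal{L}^1=\mu_X$. Box distance: $\square(X,Y)$ is the infimum of $\varepsilon\ge0$ such that there are parameters $\varphi,\psi$ of $X,Y$ and Borel $I_0\subset I$ with $\mathcal{L}^1(I_0)\ge1-\varepsilon$ and $|d_X(\varphi(s),\varphi(t))-d_Y(\psi(s),\psi(t))|\le\varepsilon$ for $s,t\in I_0$. Lipschitz order: $Y\prec X$ if there is a 1-Lipschitz $f\colon X\to Y$ with $f_*\mu_X=\mu_Y$. A pyramid is a nonempty $\square$-closed set $\mathcal{P}\subset\mathcal{X}$ such that $X\in\mathcal{P}$, $Y\prec X$ imply $Y\in\mathcal{P}$, and any $Y,Y'\in\mathcal{P}$ have a common upper bound $X\in\mathcal{P}$ for $\prec$. $\Pi$ is the set of pyramids. Pyramids $\mathcal{P}_n$ converge weakly to $\mathcal{P}$ if $\square(X,\mathcal{P}_n)\to0$ for every $X\in\mathcal{P}$ and $\liminf_n\square(X,\mathcal{P}_n)>0$ for every $X\notin\mathcal{P}$; the weak topology on $\Pi$ is the (metrizable)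 topology of weak convergence. For a Hausdorff space $T$, $\mathcal{F}(T)$ is the set of closed subsets of $T$. For a net $\{A_\lambda\}$ in $\mathcal{F}(T)$, $\mathrm{Ls}\,A_\lambda$ (resp. $\mathrm{Li}\,A_\lambda$) is the set of $x\in T$ such that every neighborhood of $x$ meets $A_\lambda$ cofinally (resp. residually); the net Kuratowski–Painlevé converges to $A\in\mathcal{F}(T)$ if $\mathrm{Li}\,A_\lambda=\mathrm{Ls}\,A_\lambda=A$. $\tau\mathrm{K}$ denotes the finest topology on $\mathcal{F}(T)$ in which every Kuratowski–Painlevé convergent net converges to its Kuratowski–Painlevé limit. Here $T=(\mathcal{X},\square)$. *)

(* Defs.v *)
From HB Require Import structures.
From mathcomp Require Import all_boot all_order all_algebra.
From mathcomp Require Import all_classical all_reals all_analysis.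
From mathcomp Require Import Rstruct Rstruct_topology.
From Stdlib Require Import Rdefinitions.

Set Implicit Arguments.
Unset Strict Implicit.
Unset Printing Implicit Defensive.
Import Order.TTheory GRing.Theory Num.Theory.
Local Open Scope classical_set_scope.
Local Open Scope ring_scope.

Notation Real := Rdefinitions.R.

Definition is_metric (X : Type) (d : X -> X -> Real) : Prop :=
  (forall x y, 0 <= d x y) /\ (forall x y, d x y = 0 <-> x = y) /\
  (forall x y, d x y = d y x) /\ (forall x y z, d x z <= d x y + d y z).

Definition mball (X : Type) (d : X -> X -> Real) (x : X) (e : Real) : set X :=
  [set y | d x y < e].

Definition mopen (X : Type) (d : X -> X -> Real) (U : set X) : Prop :=
  forall x, U x -> exists2 e : Real, 0 < e & mball d x e `<=` U.

Definition mcomplete (X : Type) (d : X -> X -> Real) : Prop :=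
  forall u : nat -> X,
    (forall e : Real, 0 < e -> exists N : nat, forall m n : nat, (leq N m) -> (leq N n) -> d (u m) (u n) < e) ->
    exists x, forall e : Real, 0 < e -> exists N : nat, forall n : nat, (leq N n) -> d x (u n) < e.

Definition mseparable (X : Type) (d : X -> X -> Real) : Prop :=
  exists s : nat -> X, forall x (e : Real), 0 < e -> exists n, d x (s n) < e.

Definition borel (X : Type) (d : X -> X -> Real) : set (set X) :=
  <<s mopen d >>.

Definition borel_probability (X : Type) (d : X -> X -> Real) (mu : set X -> Real) : Prop :=
  (forall B, borel d B -> 0 <= mu B) /\
  mu set0 = 0 /\ mu setT = 1 /\
  (forall F : nat -> set X, (forall n, borel d (F n)) -> trivIset setT F ->
     (fun n => \sum_(i < n) mu (F i)) @ \oo --> mu (\bigcup_n F n)).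

Record mmspace := MMSpace {
  mm_car :> Type;
  mm_d : mm_car -> mm_car -> Real;
  mm_mu : set mm_car -> Real;
  mm_metric : is_metric mm_d;
  mm_complete : mcomplete mm_d;
  mm_separable : mseparable mm_d;
  mm_prob : borel_probability mm_d mm_mu }.

Definition mm_supp (X : mmspace) : set X :=
  [set x | forall e : Real, 0 < e -> 0 < @mm_mu X (mball (@mm_d X) x e)].

Definition mm_iso (X Y : mmspace) : Prop :=
  exists f : X -> Y,
    (forall x x', @mm_supp X x -> @mm_supp X x' -> mm_d (f x) (f x') = mm_d x x') /\
    f @` @mm_supp X = @mm_supp Y /\
    (forall B, borel (@mm_d Y) B -> @mm_mu X (@mm_supp X `&` f @^-1` B) = @mm_mu Y B).

Definition is_mmclass (A : mmspace -> Prop) : Prop :=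
  exists X : mmspace, A = mm_iso X.

Definition mmX := {A : mmspace -> Prop | is_mmclass A}.

Definition in_class (A : mmX) (X : mmspace) : Prop := proj1_sig A X.

Definition I01 : set Real := `[0%R, 1%R[.

Definition leb : set (measurableTypeR Real) -> \bar Real := lebesgue_measure.

Definition parameter (X : mmspace) (phi : Real -> X) : Prop :=
  (forall B, borel (@mm_d X) B -> @measurable _ (measurableTypeR Real) (I01 `&` phi @^-1` B)) /\
  (forall B, borel (@mm_d X) B -> leb (I01 `&` phi @^-1` B) = (@mm_mu X B)%:E).

Definition box_cond (X Y : mmspace) (eps : Real) : Prop :=
  0 <= eps /\
  exists (phi : Real -> X) (psi : Real -> Y) (I0 : set Real),
    parameter phi /\ parameter psi /\
    @measurable _ (measurableTypeR Real) I0 /\ I0 `<=` I01 /\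
    ((1 - eps)%:E <= leb I0)%E /\
    (forall s t, I0 s -> I0 t ->
       `| mm_d (phi s) (phi t) - mm_d (psi s) (psi t) | <= eps).

Definition box (A B : mmX) : Real :=
  inf [set eps | exists X Y, in_class A X /\ in_class B Y /\ box_cond X Y eps].

Definition box_to_set (A : mmX) (P : set mmX) : Real :=
  inf [set box A B | B in P].

Definition lip_dom (B A : mmX) : Prop :=
  exists (X Y : mmspace) (f : X -> Y), in_class A X /\ in_class B Y /\
    (forall x x', mm_d (f x) (f x') <= mm_d x x') /\
    (forall S, borel (@mm_d Y) S -> @mm_mu X (f @^-1` S) = @mm_mu Y S).

Definition box_closed (S : set mmX) : Prop :=
  forall A, (forall e : Real, 0 < e -> exists2 B, S B & box A B < e) -> S A.

Definition pyramid (P : set mmX) : Prop :=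
  P !=set0 /\ box_closed P /\
  (forall A B, P A -> lip_dom B A -> P B) /\
  (forall B B', P B -> P B' -> exists2 A, P A & lip_dom B A /\ lip_dom B' A).

Definition Pi := {P : set mmX | pyramid P}.

Definition weak_cvg (Pn : nat -> Pi) (P : Pi) : Prop :=
  (forall A, proj1_sig P A ->
     (fun n => box_to_set A (proj1_sig (Pn n))) @ \oo --> (0 : Real)) /\
  (forall A, ~ proj1_sig P A ->
     (0 < limn_einf (fun n => (box_to_set A (proj1_sig (Pn n)))%:E))%E).

Definition weak_open (U : set Pi) : Prop :=
  forall P Pn, U P -> weak_cvg Pn P -> exists N : nat, forall n : nat, (leq N n) -> U (Pn n).

Definition FX := {S : set mmX | box_closed S}.

Definition box_nbhs (A : mmX) (N : set mmX) : Prop :=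
  exists2 e : Real, 0 < e & [set B | box A B < e] `<=` N.

Record directed_set := DirectedSet {
  ds_car :> Type;
  ds_le : ds_car -> ds_car -> Prop;
  ds_refl : forall i, ds_le i i;
  ds_trans : forall i j k, ds_le i j -> ds_le j k -> ds_le i k;
  ds_inhab : inhabited ds_car;
  ds_up : forall i j, exists k, ds_le i k /\ ds_le j k }.

Definition cofinally (D : directed_set) (P : D -> Prop) : Prop :=
  forall i, exists j, ds_le i j /\ P j.

Definition residually (D : directed_set) (P : D -> Prop) : Prop :=
  exists i, forall j, ds_le i j -> P j.

Definition Ls (D : directed_set) (a : D -> FX) : set mmX :=
  [set x | forall N, box_nbhs x N ->
     cofinally (fun l => exists2 y, proj1_sig (a l) y & N y)].

Definition Li (D : directed_set) (a : D -> FX) : set mmX :=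
  [set x | forall N, box_nbhs x N ->
     residually (fun l => exists2 y, proj1_sig (a l) y & N y)].

Definition KP_cvg (D : directed_set) (a : D -> FX) (A : FX) : Prop :=
  Li a = proj1_sig A /\ Ls a = proj1_sig A.

Definition is_topology (T : Type) (O : set (set T)) : Prop :=
  O setT /\ O set0 /\
  (forall F : set (set T), F `<=` O -> O (\bigcup_(U in F) U)) /\
  (forall U V, O U -> O V -> O (U `&` V)).

Definition net_cvg_in (T : Type) (O : set (set T)) (D : directed_set) (a : D -> T) (x : T) :=
  forall U, O U -> U x -> residually (fun l => U (a l)).

(* tau K : the finest topology on F(X) in which every KP-convergent net
   converges to its KP-limit; U is tauK-open iff it belongs to some topology
   with this property. *)
Definition KP_compatible (O : set (set FX)) : Prop :=
  is_topology O /\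
  forall (D : directed_set) (a : D -> FX) (A : FX), KP_cvg a A -> net_cvg_in O a A.

Definition tauK_open (U : set FX) : Prop :=
  exists O, KP_compatible O /\ O U.

Lemma pyramid_box_closed (P : Pi) : box_closed (proj1_sig P).
Proof. exact: (proj1 (proj2 (proj2_sig P))). Qed.

Definition pyr_incl (P : Pi) : FX := exist _ (proj1_sig P) (@pyramid_box_closed P).

Definition top_embedding (A B : Type) (openA : set (set A)) (openB : set (set B))
    (f : A -> B) : Prop :=
  injective f /\
  (forall V, openB V -> openA (f @^-1` V)) /\
  (forall U, openA U -> exists2 V, openB V & U = f @^-1` V).

(* Main.v *)
(** A map into the Cantor space that is nondecreasing for the lexicographic order is determined,
    up to small measure and finitely many bits, by its values on a finite grid of [0,1). Every
    Borel probability on a complete separable space is the law of such a quantile map followed by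
    a Borel decoder; this yields parameters, the gluing of two parameters of the same space (hence
    the triangle inequality for the box distance), and the compactness and separability of the
    set of laws on the cube [0,n]^n with the sup metric.

    Truncated distances to finitely many points show that any Z box-close to X dominates, for the
    Lipschitz order, a law on a cube that is still box-close to X. Consequently the
    space of classes is separable, and, among downward closed sets, staying away from a
    neighbourhood of X follows from missing a compact set of laws on a cube. Meeting a box ball and
    missing a compact set are conditions that a Kuratowski-Painleve convergent net inherits
    residually from its limit, so they are open for tau K; countably many of them determine the
    weak convergence of pyramids to a given pyramid, so finite intersections of them refine every
    sequentially open set. *)

From mathcomp Require Import all_boot all_order all_algebra.
From mathcomp Require Import all_classical all_reals all_analysis.
From mathcomp Require Import measurable_realfun Rstruct Rstruct_topology lra ring zify.
Require Import Defs.
Set Implicit Arguments.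
Unset Strict Implicit.
Unset Printing Implicit Defensive.
Import Order.TTheory GRing.Theory Num.Theory.
Local Open Scope classical_set_scope.
Local Open Scope ring_scope.

(** * Probabilities as real-valued set functions *)

Lemma Rcvg_distP (u : nat -> Real) (l : Real) : u @ \oo --> l <->
  forall e : Real, 0 < e -> exists N : nat, forall n : nat, (N <= n)%N -> `|l - u n| < e.
Proof.
split => [h e e0|h].
  by have [N _ hN] := iffLR (@cvgrPdist_lt Real Real^o nat \oo _ u l) h e e0; exists N.
apply: (iffRL (@cvgrPdist_lt Real Real^o nat \oo _ u l)) => e e0.
by have [N hN] := h e e0; exists N.
Qed.

Lemma Rcvg_eventually_cst (u : nat -> Real) (l c : Real) (N : nat) :
  u @ \oo --> l -> (forall n, (N <= n)%N -> u n = c) -> l = c.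
Proof.
move=> /Rcvg_distP h uc; apply/eqP; rewrite -subr_eq0 -normr_le0 leNgt; apply/negP => /h.
move=> [M /(_ _ (leq_maxr N M))].
by rewrite uc ?leq_maxl // ltxx.
Qed.

Lemma Rcvg_unique (u : nat -> Real) (l l' : Real) :
  u @ \oo --> l -> u @ \oo --> l' -> l = l'.
Proof.
move=> /Rcvg_distP h /Rcvg_distP h'; apply/eqP; rewrite -subr_eq0 -normr_le0 leNgt.
apply/negP => d0; have d2 : 0 < `|l - l'| / 2 by lra.
have [M hM] := h _ d2; have [N hN] := h' _ d2.
have := hM _ (leq_maxl M N); have := hN _ (leq_maxr M N).
have := ler_distD (u (maxn M N)) l l'; rewrite [`|u _ - l'|]distrC; lra.
Qed.

Section Probability.
Variables (T : Type) (S : set (set T)).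

(** The sigma-algebra is a variable, so that one group of lemmas serves the Borel probabilities of
    mm-spaces and Lebesgue measure on [0,1). *)
Definition is_prob (nu : set T -> Real) : Prop :=
  [/\ sigma_algebra setT S, (forall B, S B -> 0 <= nu B), nu set0 = 0, nu setT = 1 &
  forall F : nat -> set T, (forall n, S (F n)) -> trivIset setT F ->
     (fun n => \sum_(i < n) nu (F i)) @ \oo --> nu (\bigcup_n F n)].

Hypothesis sS : sigma_algebra setT S.

Lemma sa0 : S set0. Proof. by case: sS. Qed.
Lemma saC A : S A -> S (~` A).
Proof. by case: sS => _ h _ /h; rewrite setTD. Qed.
Lemma saT : S setT. Proof. by rewrite -setC0; exact/saC/sa0. Qed.
Lemma sa_bigcup (F : nat -> set T) : (forall n, S (F n)) -> S (\bigcup_n F n).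
Proof. by case: sS => _ _ h /h. Qed.
Lemma saU A B : S A -> S B -> S (A `|` B).
Proof.
move=> SA SB; rewrite -bigcup2E; apply: sa_bigcup => -[|[|n]] //=.
exact: sa0.
Qed.
Lemma saI A B : S A -> S B -> S (A `&` B).
Proof. by move=> SA SB; rewrite -[_ `&` _]setCK setCI; apply/saC/saU; exact: saC. Qed.
Lemma saD A B : S A -> S B -> S (A `\` B).
Proof. by move=> SA SB; rewrite setDE; apply: saI => //; exact: saC. Qed.
Lemma sa_bigcap (F : nat -> set T) : (forall n, S (F n)) -> S (\bigcap_n F n).
Proof.
by move=> SF; rewrite -[\bigcap_n _]setCK setC_bigcap; apply/saC/sa_bigcup => n; exact: saC.
Qed.
Lemma sa_countU (I : countType) (F : I -> set T) :
  (forall i, S (F i)) -> S [set x | exists i, F i x].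
Proof.
move=> SF; pose G n := if unpickle n is Some i then F i else set0.
rewrite (_ : [set x | _] = \bigcup_n G n).
  by apply: sa_bigcup => n; rewrite /G; case: unpickle => [i|]; [exact: SF|exact: sa0].
apply/seteqP; split => x /=.
  by move=> [i Fi]; exists (pickle i) => //; rewrite /G pickleK.
by move=> [n _]; rewrite /G; case: unpickle => // i; exists i.
Qed.
Lemma sa_const (P : Prop) : S [set _ | P].
Proof.
have [p|p] := pselect P.
  by rewrite (_ : [set _ | P] = setT); [exact: saT|apply/seteqP; split].
by rewrite (_ : [set _ | P] = set0); [exact: sa0|apply/seteqP; split].
Qed.
Lemma sa_forall_lt (n : nat) (F : nat -> set T) :
  (forall i, (i < n)%N -> S (F i)) -> S [set x | forall i, (i < n)%N -> F i x].
Proof.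
move=> SF; rewrite (_ : [set x | _] = \bigcap_i [set x | (i < n)%N -> F i x]).
  apply: sa_bigcap => i; case: (ltnP i n) => [lin|nli].
    rewrite (_ : [set x | _] = F i); first exact: SF.
    by apply/seteqP; split => x /=; [apply|].
  rewrite (_ : [set x | _] = setT); first exact: saT.
  by apply/seteqP; split.
apply/seteqP; split => x /=; first by move=> h i _; exact: h.
by move=> h i; exact: h.
Qed.

Variable nu : set T -> Real.
Hypothesis Pnu : is_prob nu.

Lemma pr_ge0 B : S B -> 0 <= nu B. Proof. by case: Pnu => _ h _ _ _; exact: h. Qed.
Lemma prT : nu setT = 1. Proof. by case: Pnu. Qed.
Lemma pr0 : nu set0 = 0. Proof. by case: Pnu. Qed.

Lemma pr_add A B : S A -> S B -> A `&` B = set0 -> nu (A `|` B) = nu A + nu B.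
Proof.
move=> SA SB AB; case: Pnu => _ _ n0 _ /(_ (bigcup2 A B)).
rewrite bigcup2E => h.
have /h h1 : forall n, S (bigcup2 A B n) by move=> [|[|n]] //=; exact: sa0.
have /h1 h2 : trivIset setT (bigcup2 A B) by rewrite -trivIset_bigcup2.
apply: (Rcvg_eventually_cst (N := 2) h2) => -[|[|n]] // _.
by rewrite !big_ord_recl /= big1 ?addr0.
Qed.

Lemma prC A : S A -> nu (~` A) = 1 - nu A.
Proof.
move=> SA; rewrite -prT -(setUv A) pr_add ?setICr //; first by rewrite addrC addKr.
exact: saC.
Qed.

Lemma prDI A B : S A -> S B -> nu A = nu (A `&` B) + nu (A `\` B).
Proof.
move=> SA SB; rewrite -pr_add; [by rewrite setUIDK|exact: saI|exact: saD|].
by apply/seteqP; split => x // -[[_ ?] [_]].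
Qed.

Lemma pr_le A B : S A -> S B -> A `<=` B -> nu A <= nu B.
Proof.
move=> SA SB AB; rewrite (prDI SB SA) setIC (setIidl AB) lerDl.
by apply: pr_ge0; exact: saD.
Qed.

Lemma pr_le1 A : S A -> nu A <= 1.
Proof. by move=> SA; rewrite -prT; apply: pr_le => //; exact: saT. Qed.

Lemma prI_ge A B : S A -> S B -> nu A + nu B - 1 <= nu (A `&` B).
Proof.
move=> SA SB; have := prDI SA SB; have : nu (A `\` B) <= nu (~` B).
  by apply: pr_le; [exact: saD|exact: saC|move=> x []].
by rewrite (prC SB); lra.
Qed.

Lemma prU_le A B : S A -> S B -> nu (A `|` B) <= nu A + nu B.
Proof.
move=> SA SB; have SBA := saD SB SA.
have -> : A `|` B = A `|` (B `\` A) by rewrite setUDr setDv setD0.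
rewrite pr_add //; last by rewrite setDE setICA setICr setI0.
by rewrite lerD2l; apply: pr_le => // x [].
Qed.

Lemma prI_full A B : S A -> S B -> nu A = 1 -> nu (A `&` B) = nu B.
Proof.
move=> SA SB A1; apply/eqP; rewrite eq_le; apply/andP; split.
  by apply: pr_le => //; exact: saI.
by have := prI_ge SA SB; rewrite A1; lra.
Qed.

Lemma pr_seqDU_sum (F : nat -> set T) n : (forall n, S (F n)) ->
  (forall k, S (seqDU F k)) /\ \sum_(i < n) nu (seqDU F i) = nu (\big[setU/set0]_(i < n) F i).
Proof.
move=> SF.
have SU k : S (\big[setU/set0]_(i < k) F i).
  by elim: k => [|k ih]; [rewrite big_ord0; exact: sa0|rewrite big_ord_recr /=; exact: saU].
have SD k : S (seqDU F k) by apply: saD.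
split => //; elim: n => [|n ih]; first by rewrite !big_ord0 pr0.
rewrite !big_ord_recr /= ih -pr_add //; last by rewrite /seqDU setDE setICA setICr setI0.
congr nu; apply/seteqP; split => x; first by move=> [?|[? ?]]; [left|right].
move=> [?|Fx]; first by left.
by have [?|?] := pselect ((\big[setU/set0]_(i < n) F i) x); [left|right].
Qed.

(** After disjointification the partial sums are the masses of the finite unions, and countable
    additivity makes them converge to 1. *)
Lemma pr_cover (F : nat -> set T) (e : Real) : (forall n, S (F n)) ->
  (forall x, exists n, F n x) -> 0 < e ->
  exists N, 1 - e < nu [set x | exists2 i, (i < N)%N & F i x].
Proof.
move=> SF cF e0.
have [SD _] := pr_seqDU_sum 0 SF.
case: (Pnu) => _ _ _ _ /(_ _ SD (trivIset_seqDU F)).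
rewrite -seqDU_bigcup_eq (_ : \bigcup_n F n = setT); last first.
  by apply/seteqP; split => x // _; have [n Fn] := cF x; exists n.
rewrite prT => /Rcvg_distP /(_ e e0) [N /(_ N (leqnn N))] /=.
have [_ ->] := pr_seqDU_sum N SF.
rewrite -bigcup_mkord => h; exists N.
rewrite (_ : [set x | _] = \bigcup_(i in `I_N) F i) //.
by move: h; rewrite ltr_norml => /andP[_]; lra.
Qed.

Lemma pr_bigcup0 (F : nat -> set T) : (forall n, S (F n)) ->
  (forall n, nu (F n) = 0) -> nu (\bigcup_n F n) = 0.
Proof.
move=> SF F0; have [SD _] := pr_seqDU_sum 0 SF.
case: (Pnu) => _ _ _ _ /(_ _ SD (trivIset_seqDU F)).
rewrite -seqDU_bigcup_eq => h; apply: (Rcvg_eventually_cst (N := 0) h) => n _.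
rewrite big1 // => i _; apply/eqP; rewrite eq_le pr_ge0 ?andbT //.
by rewrite -(F0 i); apply: pr_le => //; exact: subDsetl.
Qed.

End Probability.

Lemma mm_is_prob (X : mmspace) : is_prob (borel (@mm_d X)) (@mm_mu X).
Proof.
case: (mm_prob X) => h0 [h1 [h2 h3]]; split => //.
exact: smallest_sigma_algebra.
Qed.

(** Testing only the trace on [I01] makes [lam] a probability on all of [Real], so that parameters
    can be handled as total functions. *)
Definition SI : set (set Real) :=
  [set B | @measurable _ (measurableTypeR Real) (I01 `&` B)].
Definition lam (B : set Real) : Real := fine (leb (I01 `&` B)).

Lemma I01E : I01 = `[0, 1[%classic. Proof. by []. Qed.

Lemma I01P s : I01 s <-> 0 <= s < 1. Proof. by rewrite I01E /= in_itv. Qed.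

Lemma measurable_I01 : @measurable _ (measurableTypeR Real) I01.
Proof. exact: measurable_itv. Qed.

Lemma leb_I01 : leb I01 = 1%:E.
Proof. by rewrite /leb /I01 lebesgue_measure_itv /= lte_fin ltr01 oppr0 adde0. Qed.

Lemma lamE B : SI B -> leb (I01 `&` B) = (lam B)%:E.
Proof.
move=> SB; rewrite /lam fineK // ge0_fin_numE; last exact: measure_ge0.
apply: (@le_lt_trans _ _ (leb I01)); last by rewrite leb_I01 ltry.
by apply: le_measure; rewrite ?inE //; exact: measurable_I01.
Qed.

Lemma SI_sigma : sigma_algebra setT SI.
Proof.
split => [|A mA|F mF]; rewrite /SI /=.
- by rewrite setI0.
- rewrite setTD (_ : _ `&` _ = I01 `\` (I01 `&` A)).
    by apply: measurableD => //; exact: measurable_I01.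
  by rewrite setDIr setDv set0U setDE.
- by rewrite setI_bigcupr; apply: bigcupT_measurable => i; exact: mF.
Qed.

Lemma lam_prob : is_prob SI lam.
Proof.
split; first exact: SI_sigma.
- by move=> B SB; rewrite /lam fine_ge0 // measure_ge0.
- by rewrite /lam setI0 /leb measure0.
- by rewrite /lam setIT leb_I01.
move=> F SF tF.
have SU : SI (\bigcup_n F n) by apply: (sa_bigcup SI_sigma).
have mF i : @measurable _ (measurableTypeR Real) (I01 `&` F i) by exact: SF.
have tIF : trivIset setT (fun i => I01 `&` F i).
  apply/trivIsetP => i j _ _ ij; move/trivIsetP: tF => /(_ i j I I ij) Fij.
  by rewrite setIACA Fij setI0.
have h := @measure_sigma_additive _ _ _ (@lebesgue_measure Real) _ mF tIF.
have {}h : (fun n => \sum_(0 <= i < n) leb (I01 `&` F i))%E @ \oo --> (lam (\bigcup_n F n))%:E.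
  by rewrite -(lamE SU) setI_bigcupr; exact: h.
move/fine_cvg: h; rewrite (_ : _ \o _ = fun n => \sum_(i < n) lam (F i)) //.
apply/funext => n /=; rewrite (eq_bigr (fun i => (lam (F i))%:E)).
  by rewrite sumEFin /= big_mkord.
by move=> i _; exact: (lamE (SF i)).
Qed.

(** * Quantile maps into the Cantor space *)

Section Quantile.
Variable m : seq bool -> Real.
Hypothesis m_ge0 : forall w, 0 <= m w.
Hypothesis m_nil : m [::] = 1.
Hypothesis m_split : forall w, m w = m (rcons w false) + m (rcons w true).

(** Inverse distribution function for the lexicographic order: nested half-open intervals of lengths
    [m w] subdivide [0,1), and the state is the word and the left endpoint of the depth-[k] interval
    containing [s]. *)
Fixpoint qst (s : Real) (k : nat) : seq bool * Real :=
  if k is k'.+1 then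
    let: (w, a) := qst s k' in
    let c := a + m (rcons w false) in
    if s < c then (rcons w false, a) else (rcons w true, c)
  else ([::], 0).

Definition quant (s : Real) (k : nat) : bool :=
  let: (w, a) := qst s k in ~~ (s < a + m (rcons w false)).

(* [lft w] is the left endpoint of the interval of points whose code starts with [w];
   [lftr] reads [w] from its last letter. *)
Fixpoint lftr (r : seq bool) : Real :=
  if r is b :: r' then lftr r' + (if b then m (rcons (rev r') false) else 0) else 0.
Definition lft (w : seq bool) : Real := lftr (rev w).

Lemma lft_rcons w b : lft (rcons w b) = lft w + (if b then m (rcons w false) else 0).
Proof. by rewrite /lft rev_rcons /= revK. Qed.

Lemma qstE s k : qst s k = (mkseq (quant s) k, lft (mkseq (quant s) k)).
Proof.
elim: k => [|k ih] //=; rewrite mkseqS lft_rcons {2 4}/quant ih /=.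
by case: ifP => _ /=; rewrite ?addr0.
Qed.

Lemma quantE s k : quant s k =
  ~~ (s < lft (mkseq (quant s) k) + m (rcons (mkseq (quant s) k) false)).
Proof. by rewrite {1}/quant qstE. Qed.

Lemma quant_bounds s k : I01 s ->
  let w := mkseq (quant s) k in lft w <= s < lft w + m w.
Proof.
move=> /I01P s01; elim: k => [|k ih] /=.
  by rewrite /lft /= m_nil add0r.
rewrite mkseqS lft_rcons quantE.
move: ih => /=; move: (mkseq _ k) => w; rewrite (m_split w).
by case: (ltP s (lft w + m (rcons w false))) => /= h1 h2; apply/andP; split; lra.
Qed.

(** Induction on the last letter: the interval of [w] is cut at [lft w + m (rcons w false)], and
    lying in one piece implies lying in the whole, which fixes the earlier bits. *)
Lemma quant_cylP s w : I01 s ->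
  mkseq (quant s) (size w) = w <-> lft w <= s < lft w + m w.
Proof.
move=> s01; split => [<-|]; first exact: quant_bounds.
elim/last_ind: w => [|w b ih] //; rewrite lft_rcons size_rcons mkseqS => h.
have -> : mkseq (quant s) (size w) = w.
  apply: ih; move: h; rewrite (m_split w).
  by have := m_ge0 (rcons w true); have := m_ge0 (rcons w false); case: b; lra.
congr rcons; rewrite quantE (_ : mkseq _ _ = w).
  by move: h; case: b; case: ltP => //=; lra.
apply: ih; move: h; rewrite (m_split w).
by have := m_ge0 (rcons w true); have := m_ge0 (rcons w false); case: b; lra.
Qed.

Lemma lft_bounds w : 0 <= lft w /\ lft w + m w <= 1.
Proof.
elim/last_ind: w => [|w b ih]; first by rewrite /lft /= m_nil; lra.
rewrite lft_rcons; move: ih; rewrite (m_split w).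
by have := m_ge0 (rcons w true); have := m_ge0 (rcons w false); case: b; lra.
Qed.

Lemma quant_cyl_itv w :
  I01 `&` [set s | mkseq (quant s) (size w) = w] = `[lft w, lft w + m w[%classic.
Proof.
have [l0 l1] := lft_bounds w.
apply/seteqP; split => s /=; rewrite in_itv /=.
  by move=> [s01 /(quant_cylP _ s01)].
move=> h; have s01 : I01 s by apply/I01P; lra.
by split => //; apply/quant_cylP.
Qed.

Lemma quant_cyl_SI w : SI [set s | mkseq (quant s) (size w) = w].
Proof. by rewrite /SI /= quant_cyl_itv; exact: measurable_itv. Qed.

Lemma quant_cyl_lam w : lam [set s | mkseq (quant s) (size w) = w] = m w.
Proof.
rewrite /lam quant_cyl_itv /leb lebesgue_measure_itv /= lte_fin.
case: ifP => [_|/negbT]; first by rewrite -EFinB /=; ring.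
by rewrite -leNgt /=; have := m_ge0 w; lra.
Qed.

End Quantile.

(** Prefixes read in binary: the lexicographic order at length [k] becomes the order of the
    integers. *)
Fixpoint vcode (om : nat -> bool) (k : nat) : nat :=
  if k is k'.+1 then (2 * vcode om k' + om k')%N else 0%N.

Definition qmono (q : Real -> nat -> bool) : Prop :=
  forall k s t, I01 s -> I01 t -> s <= t -> (vcode (q s) k <= vcode (q t) k)%N.

Lemma vcode_inj om om' k : vcode om k = vcode om' k -> forall i, (i < k)%N -> om i = om' i.
Proof.
elim: k => [|k ih] //= h i; rewrite ltnS leq_eqVlt => /predU1P[->|]; last first.
  by apply: ih; move: h; case: (om k); case: (om' k) => /=; lia.
by move: h; case: (om k); case: (om' k) => //=; lia.
Qed.

Lemma vcode_eq om om' k : (forall i, (i < k)%N -> om i = om' i) -> vcode om k = vcode om' k.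
Proof.
elim: k => [|k ih] h //=; rewrite ih ?h // => i ik; apply: h; exact: ltnW.
Qed.

Lemma vcode_lt om k : (vcode om k < 2 ^ k)%N.
Proof. by elim: k => [|k ih] //=; rewrite expnS; case: (om k) => /=; lia. Qed.

Lemma quant_mono m : qmono (quant m).
Proof.
move=> k s t _ _ st.
(* After equal prefixes, [s] and [t] are compared with the same cut point, so [s <= t] orders the
   next bits; strictly ordered prefixes stay so after any extension. *)
suff [h|] : mkseq (quant m s) k = mkseq (quant m t) k \/
    (vcode (quant m s) k < vcode (quant m t) k)%N.
- rewrite (@vcode_eq _ (quant m t)) // => i ik.
  by rewrite -(nth_mkseq false (quant m s) ik) h nth_mkseq.
- exact: ltnW.
elim: k => [|k [ih|ih]]; first by left.
- rewrite !mkseqS ih /= (@vcode_eq _ (quant m t) k); last first.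
    by move=> i ik; rewrite -(nth_mkseq false (quant m s) ik) ih nth_mkseq.
  rewrite !quantE ih; move: (_ + m _) => c.
  case: (ltP t c) => tc; case: (ltP s c) => sc /=; [by left|by move: (le_lt_trans st tc); rewrite ltNge sc| |by left].
  by right; rewrite addn0 addn1.
- right => /=; case: (quant m s k); case: (quant m t k) => /=; lia.
Qed.

(** The cut points that decide the first [n] bits involve only words of length at most [n]. This is
    how the re-sorted versions of two parameters come to share bits. *)
Lemma quant_agree m m' n : (forall w, (size w <= n)%N -> m w = m' w) ->
  forall s i, (i < n)%N -> quant m s i = quant m' s i.
Proof.
move=> mm s; have H k : (k <= n)%N -> qst m s k = qst m' s k.
  elim: k => [|k ih] kn //=; rewrite -ih; last exact: ltnW.
  rewrite qstE mm //; by rewrite size_rcons size_mkseq.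
move=> i il; rewrite /quant -H; last exact: ltnW.
by rewrite qstE mm // size_rcons size_mkseq.
Qed.

(** * Cylinders and the sigma-algebra of the Cantor space *)

Definition cyl (w : seq bool) : set (nat -> bool) := [set om | mkseq om (size w) = w].
(** The empty set is added for closure under intersection: two cylinders are nested or disjoint. *)
Definition cylG : set (set (nat -> bool)) := [set E | E = set0 \/ exists w, E = cyl w].
Definition CS : set (set (nat -> bool)) := <<s cylG >>.

Lemma CS_sigma : sigma_algebra setT CS. Proof. exact: smallest_sigma_algebra. Qed.

Lemma cylE w : cyl w = [set om | forall i, (i < size w)%N -> om i = nth false w i].
Proof.
apply/seteqP; split => om /=; first by move=> <- i; rewrite size_mkseq => ik; rewrite nth_mkseq.
move=> h; apply: (@eq_from_nth _ false); rewrite size_mkseq // => i ik.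
by rewrite nth_mkseq // h.
Qed.

Lemma cyl_setI u w : (size u <= size w)%N -> cylG (cyl u `&` cyl w).
Proof.
move=> uw; have [h|h] := pselect (forall i, (i < size u)%N -> nth false u i = nth false w i).
  right; exists w; rewrite !cylE; apply/seteqP; split => om /=; first by case.
  by move=> H; split => // i iu; rewrite h // H // (leq_trans iu).
left; rewrite !cylE; apply/seteqP; split => om //= -[h1 h2].
by apply: h => i iu; rewrite -h1 // h2 // (leq_trans iu).
Qed.

Lemma cylG_setI : setI_closed cylG.
Proof.
move=> A B [->|[u ->]] [->|[w ->]]; rewrite ?set0I ?setI0; try by left.
have [uw|wu] := leqP (size u) (size w); first exact: cyl_setI.
by rewrite setIC; apply: cyl_setI; exact: ltnW.
Qed.

Lemma CS_cyl w : CS (cyl w).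
Proof. by apply: sub_sigma_algebra; right; exists w. Qed.

Lemma CS_prefix M (P : seq bool -> Prop) : CS [set om | P (mkseq om M)].
Proof.
rewrite (_ : [set om | _] = [set om | exists w, ([set _ | size w = M /\ P w] `&` cyl w) om]).
  apply: (sa_countU CS_sigma) => w; apply: (saI CS_sigma); last exact: CS_cyl.
  exact: (sa_const CS_sigma).
apply/seteqP; split => om /=.
  by move=> PM; exists (mkseq om M); rewrite /cyl /= size_mkseq.
by move=> [w [[sw Pw]]]; rewrite /cyl /= sw => ->.
Qed.

Lemma CS_bit i : CS [set om : nat -> bool | om i].
Proof.
rewrite (_ : [set om : nat -> bool | om i] = [set om | nth false (mkseq om i.+1) i]).
  exact: (CS_prefix i.+1 (fun w => nth false w i)).
by apply/seteqP; split => om /=; rewrite nth_mkseq.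
Qed.

(** Dynkin's argument: the sets with measurable preimages of equal mass form a Dynkin system, and
    the generating cylinders are closed under intersection. *)
Lemma CS_transport (T T' : Type) (S : set (set T)) (S' : set (set T'))
    (nu : set T -> Real) (nu' : set T' -> Real)
    (b : T -> nat -> bool) (b' : T' -> nat -> bool) :
  is_prob S nu -> is_prob S' nu' ->
  (forall w, [/\ S (b @^-1` cyl w), S' (b' @^-1` cyl w) &
                nu (b @^-1` cyl w) = nu' (b' @^-1` cyl w)]) ->
  forall E, CS E -> [/\ S (b @^-1` E), S' (b' @^-1` E) & nu (b @^-1` E) = nu' (b' @^-1` E)].
Proof.
move=> P P' H E; rewrite /CS -(setI_closed_g_dynkin_g_sigma_algebra cylG_setI).
have [sS _ n0 nT nadd] := P; have [sS' _ n0' nT' nadd'] := P'.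
pose G := [set E | [/\ S (b @^-1` E), S' (b' @^-1` E) & nu (b @^-1` E) = nu' (b' @^-1` E)]].
apply: (@smallest_sub _ _ _ G); last first.
  move=> A [->|[w ->]]; last exact: H.
  by rewrite /G /= !preimage_set0; split; [exact: sa0|exact: sa0|rewrite n0].
split.
- by rewrite /G /= !preimage_setT; split; [exact: saT|exact: saT|rewrite nT].
- move=> A [h1 h2 h3]; split; [exact: (saC sS h1)|exact: (saC sS' h2)|].
  have e1 := prC sS P h1; have e2 := prC sS' P' h2.
  by transitivity (1 - nu (b @^-1` A)); [exact: e1|rewrite h3; exact/esym/e2].
- move=> F tF GF; rewrite /G /= !preimage_bigcup.
  have tb (U : Type) (c : U -> nat -> bool) : trivIset setT (fun n => c @^-1` F n).
    apply/trivIsetP => i j _ _ ij; move/trivIsetP: tF => /(_ i j I I ij) Fij.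
    by rewrite -preimage_setI Fij preimage_set0.
  split; [by apply: sa_bigcup => // n; case: (GF n)|by apply: sa_bigcup => // n; case: (GF n)|].
  have h : forall n, S (b @^-1` F n) by move=> n; case: (GF n).
  have h' : forall n, S' (b' @^-1` F n) by move=> n; case: (GF n).
  apply: Rcvg_unique (nadd _ h (tb _ b)) _.
  rewrite (_ : (fun n => _) = fun n => \sum_(i < n) nu' (b' @^-1` F i)).
    exact: (nadd' _ h' (tb _ b')).
  by apply/funext => n; apply: eq_bigr => i _; case: (GF i).
Qed.

Section QuantileLaw.
Variables (T : Type) (S : set (set T)) (nu : set T -> Real) (b : T -> nat -> bool).
Hypothesis Pnu : is_prob S nu.
Hypothesis Sb : forall i, S [set x | b x i].

Definition mass (w : seq bool) : Real := nu (b @^-1` cyl w).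

Lemma S_cyl w : S (b @^-1` cyl w).
Proof.
have [sS _ _ _ _] := Pnu.
rewrite cylE; apply: (sa_forall_lt sS) => i _.
case: (nth false w i); first exact: Sb.
rewrite (_ : (fun x => _) = ~` [set x | b x i]); first exact: (saC sS (Sb i)).
by apply/seteqP; split => x /=; case: (b x i).
Qed.

Lemma mass_ge0 w : 0 <= mass w.
Proof. by apply: (pr_ge0 Pnu); exact: S_cyl. Qed.

Lemma mass_nil : mass [::] = 1.
Proof.
rewrite /mass -(prT Pnu); congr nu; by apply/seteqP; split.
Qed.

Lemma mass_split w : mass w = mass (rcons w false) + mass (rcons w true).
Proof.
have [sS _ _ _ _] := Pnu.
rewrite /mass -(pr_add sS Pnu) //; try exact: S_cyl.
  congr nu; rewrite -preimage_setU; congr (_ @^-1` _).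
  apply/seteqP; split => om; rewrite /cyl /= !size_rcons !mkseqS.
    by move=> ->; case: (om (size w)); [right|left].
  by case=> /rcons_inj [].
apply/seteqP; split => x //; rewrite /cyl /= !size_rcons !mkseqS.
by case=> /rcons_inj [_ ->] /rcons_inj [].
Qed.

(** Both laws give the cylinder of [w] the value [mass w], since its preimage under the quantile map
    is an interval of that length. *)
Lemma quant_law E : CS E ->
  [/\ SI (quant mass @^-1` E), S (b @^-1` E) & lam (quant mass @^-1` E) = nu (b @^-1` E)].
Proof.
apply: (CS_transport lam_prob Pnu) => w; split.
- exact: (quant_cyl_SI mass_ge0 mass_nil mass_split w).
- exact: S_cyl.
- exact: (quant_cyl_lam mass_ge0 mass_nil mass_split w).
Qed.

End QuantileLaw.

(** * Decoding the Cantor space; existence of parameters *)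

Definition halfpow (k : nat) : Real := 2^-1 ^+ k.

Lemma halfpow_gt0 k : 0 < halfpow k. Proof. by apply: exprn_gt0; lra. Qed.
Lemma halfpowS k : halfpow k.+1 = halfpow k / 2. Proof. by rewrite /halfpow exprSr. Qed.
Lemma halfpow_small (e : Real) : 0 < e -> exists k, halfpow k < e.
Proof.
move=> e0; exists (Num.bound e^-1); rewrite /halfpow exprVn -[ltRHS]invrK ltf_pV2 ?posrE ?invr_gt0 //.
exact: upper_nthrootP.
Qed.

Lemma halfpow_lt (c e : Real) : 0 < c -> 0 < e -> exists k, c * halfpow k < e.
Proof.
move=> c0 e0; have [k hk] := halfpow_small (divr_gt0 e0 c0); exists k.
by rewrite mulrC -ltr_pdivlMr.
Qed.

Lemma ler_limP (a b : Real) : (forall e, 0 < e -> a <= b + e) -> a <= b.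
Proof. by move=> h; apply/ler_addgt0Pr. Qed.

Section MetricBasics.
Variables (X : Type) (d : X -> X -> Real).
Hypothesis dm : is_metric d.

Lemma metric_ge0 x y : 0 <= d x y. Proof. by case: dm. Qed.
Lemma metric_sym x y : d x y = d y x. Proof. by case: dm => _ [_ [h _]]. Qed.
Lemma metric_tri x y z : d x z <= d x y + d y z. Proof. by case: dm => _ [_ [_ h]]. Qed.
Lemma metric_refl x : d x x = 0. Proof. by case: dm => _ [h _]; apply/h. Qed.
Lemma metric_eq x y : d x y <= 0 -> x = y.
Proof. by move=> h; case: dm => h0 [h1 _]; apply/h1/le_anti; rewrite h h0. Qed.

Lemma mopen_borel U : mopen d U -> borel d U.
Proof. exact: sub_sigma_algebra. Qed.

Lemma mopen_ball x e : mopen d (mball d x e).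
Proof.
move=> y xy; exists (e - d x y); first by move: xy; rewrite /mball /=; lra.
by move=> z; rewrite /mball /= => yz; have := metric_tri x y z; lra.
Qed.

Lemma borel_ball x e : borel d (mball d x e).
Proof. by apply: mopen_borel; exact: mopen_ball. Qed.

Lemma borel_sigma : sigma_algebra setT (borel d).
Proof. exact: smallest_sigma_algebra. Qed.

End MetricBasics.

Lemma borel_preimage (T : Type) (S : set (set T)) (X : Type) (d : X -> X -> Real)
    (f : T -> X) : sigma_algebra setT S ->
  (forall U, mopen d U -> S (f @^-1` U)) -> forall B, borel d B -> S (f @^-1` B).
Proof.
move=> sS h; apply: (@smallest_sub _ _ _ [set B | S (f @^-1` B)]) => //; split.
- by rewrite /= preimage_set0; exact: sa0.
- by move=> A /= SA; rewrite setTD; exact: (saC sS SA).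
- by move=> F SF; rewrite /= preimage_bigcup; apply: sa_bigcup.
Qed.

Section Decode.
Variables (X : Type) (d : X -> X -> Real).
Hypotheses (dm : is_metric d) (dc : mcomplete d).
Variables (s : nat -> X) (R : nat -> (nat -> bool) -> nat).

(** A new index is accepted only when its centre is close to the previous one. The centres are thus
    Cauchy for every [om], even one that codes no point, and the decoder is total. *)
Fixpoint stage (k : nat) (om : nat -> bool) : nat :=
  if k is k'.+1 then
    if d (s (stage k' om)) (s (R k om)) < 2 * halfpow k' then R k om else stage k' om
  else R 0 om.

(** Step [i] moves by at most [2 * halfpow i]; these bounds telescope to the right-hand side. *)
Lemma stage_dist om k j :
  d (s (stage k om)) (s (stage (k + j) om)) <= 4 * halfpow k - 4 * halfpow (k + j).
Proof.
elim: j => [|j ih]; first by rewrite addn0 (metric_refl dm) subrr.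
rewrite addnS halfpowS; apply: (le_trans (metric_tri dm _ (s (stage (k + j) om)) _)).
suff : d (s (stage (k + j) om)) (s (stage (k + j).+1 om)) <= 2 * halfpow (k + j) by move: ih; lra.
rewrite /=; case: ifP => [/ltW //|_].
by rewrite (metric_refl dm); have := halfpow_gt0 (k + j); lra.
Qed.

Lemma stage_lim om : exists x, forall e : Real, 0 < e ->
  exists N : nat, forall n : nat, leq N n -> d x (s (stage n om)) < e.
Proof.
apply: dc => e e0; have [N hN] : exists N, 8 * halfpow N < e by apply: halfpow_lt => //; lra.
exists N => a b aN bN.
apply: (le_lt_trans (metric_tri dm _ (s (stage N om)) _)); rewrite (metric_sym dm).
have := stage_dist om N (a - N); have := stage_dist om N (b - N); rewrite !subnKC //.
by have := halfpow_gt0 a; have := halfpow_gt0 b; lra.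
Qed.

Definition decode (om : nat -> bool) : X := projT1 (cid (stage_lim om)).

Lemma decode_dist om k : d (s (stage k om)) (decode om) <= 4 * halfpow k.
Proof.
rewrite /decode; case: cid => x /= hx; apply: ler_limP => e e0.
have [N hN] := hx e e0; have := hN _ (leq_addl k N).
have := stage_dist om k N; have := metric_tri dm (s (stage k om)) (s (stage (k + N) om)) x.
by rewrite [d x _](metric_sym dm); have := halfpow_gt0 (k + N); lra.
Qed.

Lemma stage_agree om om' k : (forall j, (j <= k)%N -> R j om = R j om') -> stage k om = stage k om'.
Proof.
elim: k => [|k ih] h /=; first exact: h.
by rewrite ih ?h // => j jk; apply: h; exact: leqW.
Qed.

Lemma decode_agree om om' k : (forall j, (j <= k)%N -> R j om = R j om') ->
  d (decode om) (decode om') <= 8 * halfpow k.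
Proof.
move=> /stage_agree h; have := decode_dist om k; have := decode_dist om' k; rewrite h.
by have := metric_tri dm (decode om) (s (stage k om')) (decode om'); rewrite [d (decode om) (s _)](metric_sym dm); lra.
Qed.

(** Indices that truly approximate [x] pass every test: consecutive centres are closer than
    [3/2 * halfpow k], below the threshold [2 * halfpow k]. *)
Lemma decode_code om x : (forall k, d x (s (R k om)) < halfpow k) -> decode om = x.
Proof.
move=> h; have rE k : stage k om = R k om.
  elim: k => [|k ih] //=; rewrite ih ifT //.
  have := h k; have := h k.+1; rewrite halfpowS; have := metric_tri dm (s (R k om)) x (s (R k.+1 om)).
  by rewrite [d (s _) x](metric_sym dm); have := halfpow_gt0 k; lra.
apply: (metric_eq dm); apply: ler_limP => e e0.
have [k hk] : exists k, 5 * halfpow k < e by apply: halfpow_lt => //; lra.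
have := decode_dist om k; rewrite rE; have := h k.
have := metric_tri dm (decode om) (s (R k om)) x.
by rewrite [d (decode om) (s _)](metric_sym dm) [d (s _) x](metric_sym dm); lra.
Qed.

Hypothesis R_meas : forall k n, CS [set om | R k om = n].

Lemma stage_meas k n : CS [set om | stage k om = n].
Proof.
elim: k n => [|k ih] n; first exact: R_meas.
pose F (p : nat * nat) := [set om | stage k om = p.1] `&` [set om | R k.+1 om = p.2] `&`
  [set _ | (if d (s p.1) (s p.2) < 2 * halfpow k then p.2 else p.1) = n].
rewrite (_ : [set om | _] = [set om | exists p, F p om]).
  apply: (sa_countU CS_sigma) => p; apply: (saI CS_sigma); last exact: (sa_const CS_sigma).
  by apply: (saI CS_sigma).
apply/seteqP; split => om /=.
  by move=> h; exists (stage k om, R k.+1 om).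
by move=> [[a b]] /= [[<- <-]].
Qed.

Lemma decode_meas B : borel d B -> CS (decode @^-1` B).
Proof.
apply: (borel_preimage CS_sigma) => U oU.
(* The decoded point is within [4 * halfpow k] of its stage-[k] centre, so the ball of radius
   [5 * halfpow k] about the centre contains it, and lies within [9 * halfpow k] of it. The preimage
   is thus a countable union of stage events. *)
rewrite (_ : _ @^-1` _ = [set om | exists p : nat * nat,
   ([set om | stage p.1 om = p.2] `&` [set _ | mball d (s p.2) (5 * halfpow p.1) `<=` U]) om]).
  apply: (sa_countU CS_sigma) => p; apply: (saI CS_sigma); last exact: (sa_const CS_sigma).
  exact: stage_meas.
apply/seteqP; split => om /=.
  move=> /oU [e e0 eU]; have [k hk] : exists k, 9 * halfpow k < e by apply: halfpow_lt => //; lra.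
  exists (k, stage k om); split => //= y; rewrite /mball /= => ky; apply: eU; rewrite /mball /=.
  have := decode_dist om k; have := metric_tri dm (decode om) (s (stage k om)) y.
  by rewrite [d (decode om) (s _)](metric_sym dm); lra.
move=> [[k n]] /= [<-]; apply; rewrite /mball /=; have := decode_dist om k.
by have := halfpow_gt0 k; lra.
Qed.

End Decode.

Section Code.
Variables (X : Type) (d : X -> X -> Real) (s : nat -> X).

Definition code (x : X) (i : nat) : bool :=
  if (unpickle i : option (nat * nat)) is Some (k, n) then d x (s n) < halfpow k else false.

Lemma codeE x k n : code x (pickle (k, n)) = (d x (s n) < halfpow k).
Proof. by rewrite /code pickleK. Qed.

Lemma code_borel i : is_metric d -> borel d [set x | code x i].
Proof.
move=> dm; rewrite /code; case: (unpickle i : option (nat * nat)) => [[k n]|].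
  rewrite (_ : [set x | _] = mball d (s n) (halfpow k)); first exact: (borel_ball dm).
  by apply/seteqP; split => x; rewrite /mball /= (metric_sym dm).
exact: (sa_const (@borel_sigma _ d)).
Qed.

Definition least_hit (k : nat) (om : nat -> bool) : nat :=
  if pselect (exists n, om (pickle (k, n))) is left h then ex_minn h else 0%N.

Lemma least_hit_code x k : (exists n, d x (s n) < halfpow k) -> d x (s (least_hit k (code x))) < halfpow k.
Proof.
move=> [n hn]; rewrite /least_hit; case: pselect => [h|]; last first.
  by case; exists n; rewrite codeE.
by case: ex_minnP => j; rewrite codeE.
Qed.

Lemma least_hit_meas k n : CS [set om | least_hit k om = n].
Proof.
have bit (i : nat) := CS_bit (pickle (k, i)).
pose E := [set om : nat -> bool | exists i : nat, om (pickle (k, i))].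
have mE : CS E by exact: (sa_countU CS_sigma).
pose L := [set om : nat -> bool | om (pickle (k, n))] `&`
  [set om | forall i, (i < n)%N -> (~` [set om : nat -> bool | om (pickle (k, i))]) om].
have mL : CS L.
  apply: (saI CS_sigma) => //; apply: (sa_forall_lt CS_sigma) => i _.
  exact: (saC CS_sigma).
rewrite (_ : [set om | _] = L `|` (~` E `&` [set _ | n = 0%N])).
  apply: (saU CS_sigma) => //; apply: (saI CS_sigma); [exact: (saC CS_sigma)|].
  exact: (sa_const CS_sigma).
apply/seteqP; split => om /=.
  rewrite /least_hit; case: pselect => [h|h]; last by move=> <-; right.
  case: ex_minnP => j hj jmin jn; left; rewrite /L -jn.
  by split => // i ij /jmin; rewrite leqNgt ij.
rewrite /least_hit; case: pselect => [h|h]; last first.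
  by case=> [[hn _]|[_ ->] //]; case: h; exists n.
case=> [[hn hmin]|[] //]; case: ex_minnP => j hj jmin.
apply/eqP; rewrite eqn_leq jmin //= leqNgt; apply/negP => /hmin; exact.
Qed.

Variable F : nat -> nat.

(** Unlike [least_hit], the search stops after [F k] centres and so reads finitely many bits. It is
    correct where [F k] balls cover, as on a cube, and makes the decoder uniformly continuous. *)
Definition bounded_hit (k : nat) (om : nat -> bool) : nat :=
  find (fun n => om (pickle (k, n))) (iota 0 (F k)).

Lemma bounded_hit_code x k : (exists2 n, (n < F k)%N & d x (s n) < halfpow k) ->
  d x (s (bounded_hit k (code x))) < halfpow k.
Proof.
move=> [n nF hn]; rewrite /bounded_hit.
have hh : has (fun n => code x (pickle (k, n))) (iota 0 (F k)).
  by apply/hasP; exists n; rewrite ?mem_iota ?codeE.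
have := nth_find 0%N hh; rewrite nth_iota ?add0n ?codeE //.
by move: hh; rewrite has_find size_iota.
Qed.

Lemma bounded_hit_prefix k : exists M : nat, forall om om',
  (forall i, (i < M)%N -> om i = om' i) -> forall j, (j <= k)%N -> bounded_hit j om = bounded_hit j om'.
Proof.
have H j : exists M : nat, forall om om',
    (forall i, (i < M)%N -> om i = om' i) -> bounded_hit j om = bounded_hit j om'.
  exists (\max_(n < F j) (pickle (j, val n))).+1 => om om' h; apply: eq_in_find => n.
  rewrite mem_iota /= add0n => nF; apply: h; rewrite ltnS.
  exact: (leq_bigmax (Ordinal nF)).
elim: k => [|k [M hM]].
  by have [M hM] := H 0%N; exists M => om om' h j; rewrite leqn0 => /eqP ->; exact: hM.
have [M' hM'] := H k.+1; exists (maxn M M') => om om' h j.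
rewrite leq_eqVlt => /predU1P[->|jk].
  by apply: hM' => i iM; apply: h; rewrite leq_max iM orbT.
by apply: hM => // i iM; apply: h; rewrite leq_max iM.
Qed.

Lemma bounded_hit_meas k n : CS [set om | bounded_hit k om = n].
Proof.
have [M hM] := bounded_hit_prefix k.
rewrite (_ : [set om | _] = [set om | bounded_hit k (nth false (mkseq om M)) = n]).
  exact: (CS_prefix M (fun w => bounded_hit k (nth false w) = n)).
have e om : bounded_hit k om = bounded_hit k (nth false (mkseq om M)).
  by apply: hM => // i iM; rewrite nth_mkseq.
by apply/seteqP; split => om /=; rewrite -e.
Qed.

End Code.

(* Every Borel probability on a complete separable space is the law of the
   composite of the Lebesgue quantile map into the Cantor space with the decoder. *)
Lemma prob_param (X : Type) (d : X -> X -> Real) (nu : set X -> Real) :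
  is_metric d -> mcomplete d -> mseparable d -> is_prob (borel d) nu ->
  exists phi : Real -> X, forall B, borel d B ->
    SI (phi @^-1` B) /\ lam (phi @^-1` B) = nu B.
Proof.
move=> dm dc [s ds] Pnu.
pose q := quant (mass nu (code d s)).
exists (fun t => decode dm dc s least_hit (q t)) => B bB.
have mB := decode_meas dm dc s least_hit_meas bB.
have [h1 h2 h3] := quant_law Pnu (fun i => code_borel s i dm) mB.
split => //; rewrite -[RHS](_ : nu (code d s @^-1` (decode dm dc s least_hit @^-1` B)) = _) //.
have gE x : decode dm dc s least_hit (code d s x) = x.
  by apply: decode_code => k; exact: (least_hit_code (ds x _ (halfpow_gt0 k))).
by congr nu; apply/seteqP; split => x /=; rewrite gE.
Qed.

Lemma parameterP (X : mmspace) (phi : Real -> X) : parameter phi <->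
  forall B, borel (@mm_d X) B -> SI (phi @^-1` B) /\ lam (phi @^-1` B) = mm_mu B.
Proof.
split => [[h1 h2] B bB|h].
  by split; [exact: h1|rewrite /lam h2].
split => B bB; have [h1 h2] := h B bB; first exact: h1.
by rewrite (lamE h1) h2.
Qed.

Lemma parameter_exists (X : mmspace) : exists phi : Real -> X, parameter phi.
Proof.
have [phi h] := prob_param (mm_metric X) (@mm_complete X) (mm_separable X) (mm_is_prob X).
by exists phi; apply/parameterP.
Qed.

(** * The box distance on representatives *)

Lemma lam_ext (A B : set Real) : (forall t, I01 t -> A t <-> B t) -> lam A = lam B.
Proof.
move=> h; rewrite /lam; congr (fine (leb _)).
by apply/seteqP; split => t [t1 t2]; split => //; apply/h.
Qed.

Lemma lamI_ge A B : SI A -> SI B -> lam A + lam B - 1 <= lam (A `&` B).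
Proof. exact: (prI_ge SI_sigma lam_prob). Qed.

Lemma box_condP (X Y : mmspace) (eps : Real) : box_cond X Y eps <->
  0 <= eps /\ exists (phi : Real -> X) (psi : Real -> Y) (J : set Real),
    [/\ parameter phi, parameter psi, SI J, 1 - eps <= lam J &
     forall s t, I01 s -> I01 t -> J s -> J t ->
       `| mm_d (phi s) (phi t) - mm_d (psi s) (psi t) | <= eps].
Proof.
split=> [[e0 [phi [psi [I0 [h1 [h2 [h3 [h4 [h5 h6]]]]]]]]]|[e0 [phi [psi [J [h1 h2 h3 h4 h5]]]]]].
  have SJ : SI I0 by rewrite /SI /= setIC (setIidl h4).
  split => //; exists phi, psi, I0; split => // [|s t _ _]; last exact: h6.
  by rewrite -lee_fin -(lamE SJ) setIC (setIidl h4).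
split => //; exists phi, psi, (I01 `&` J); split => //; split => //; split => //.
split; first exact: subIsetl.
split; first by rewrite (lamE h3) lee_fin.
by move=> s t [s1 s2] [t1 t2]; exact: h5.
Qed.

Lemma box_cond_sym (X Y : mmspace) (eps : Real) : box_cond X Y eps -> box_cond Y X eps.
Proof.
move=> /box_condP [e0 [phi [psi [J [h1 h2 h3 h4 h5]]]]]; apply/box_condP; split => //.
by exists psi, phi, J; split => // s t s1 t1 Js Jt; rewrite distrC; exact: h5.
Qed.

Lemma box_cond_refl (X : mmspace) (eps : Real) : 0 <= eps -> box_cond X X eps.
Proof.
move=> e0; have [phi p] := parameter_exists X; apply/box_condP; split => //.
exists phi, phi, setT; split => //; first exact: (saT SI_sigma).
  by rewrite (prT lam_prob); lra.
by move=> s t _ _ _ _; rewrite subrr normr0.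
Qed.

Lemma mm_point (X : mmspace) : exists x : X, True.
Proof. by have [s _] := mm_separable X; exists (s 0%N). Qed.

(** * Supports and invariance under mm-isomorphism *)

Section Support.
Variable X : mmspace.
Notation d := (@mm_d X).
Let dm := mm_metric X.
Let P := mm_is_prob X.

Lemma supp_open : mopen d (~` @mm_supp X).
Proof.
move=> x /= /existsNP [e] /not_implyP [e0 /negP]; rewrite -leNgt => m0.
exists e => // y xy ys; have ey : 0 < e - d x y by move: xy; rewrite /mball /=; lra.
have := ys _ ey; apply/negP; rewrite -leNgt; apply: le_trans m0.
apply: (pr_le (@borel_sigma _ d) P); try exact: (borel_ball dm).
by move=> z; rewrite /mball /= => yz; have := metric_tri dm x y z; lra.
Qed.

Lemma supp_borel : borel d (@mm_supp X).
Proof.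
rewrite -[@mm_supp X]setCK; apply: (saC (@borel_sigma _ d)).
exact: (mopen_borel supp_open).
Qed.

(** By separability, countably many null balls centred on the dense sequence cover the complement of
    the support. *)
Lemma supp_full : mm_mu (@mm_supp X) = 1.
Proof.
have [s ds] := mm_separable X; have sb := @borel_sigma _ d.
pose F i := if (unpickle i : option (nat * nat)) is Some (k, n) then
  (if pselect (mm_mu (mball d (s n) (halfpow k)) = 0) then mball d (s n) (halfpow k) else set0) else set0.
have bF i : borel d (F i).
  rewrite /F; case: unpickle => [[k n]|]; last exact: (sa0 sb).
  by case: pselect => ?; [exact: (borel_ball dm)|exact: (sa0 sb)].
have F0 i : mm_mu (F i) = 0.
  rewrite /F; case: unpickle => [[k n]|]; last exact: (pr0 P).
  by case: pselect => // ?; exact: (pr0 P).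
have := pr_bigcup0 sb P bF F0.
have : mm_mu (~` @mm_supp X) <= mm_mu (\bigcup_n F n).
  apply: (pr_le sb P); [exact: (mopen_borel supp_open)|exact: (sa_bigcup sb)|].
  move=> x /= /existsNP [e] /not_implyP [e0 /negP]; rewrite -leNgt => m0.
  have [k hk] : exists k, 2 * halfpow k < e by apply: halfpow_lt => //; lra.
  have [n hn] := ds x _ (halfpow_gt0 k).
  exists (pickle (k, n)) => //; rewrite /F pickleK; case: pselect => [?|]; last first.
    case; apply/eqP; rewrite eq_le (pr_ge0 P) ?andbT; last exact: (borel_ball dm).
    apply: le_trans m0; apply: (pr_le sb P); try exact: (borel_ball dm).
    by move=> z; rewrite /mball /= => nz; have := metric_tri dm x (s n) z; lra.
  by rewrite /mball /= (metric_sym dm).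
by rewrite (prC sb P supp_borel) => h1 h2; have := pr_le1 sb P supp_borel; lra.
Qed.

Lemma muI_supp B : borel d B -> mm_mu (@mm_supp X `&` B) = mm_mu B.
Proof. by move=> bB; exact: (prI_full (@borel_sigma _ d) P supp_borel bB supp_full). Qed.

End Support.
Arguments supp_open : clear implicits.
Arguments supp_borel : clear implicits.
Arguments supp_full : clear implicits.

Section Iso.
Variables (X Y : mmspace) (f : X -> Y) (y0 : Y).
Hypothesis fiso : forall x x', @mm_supp X x -> @mm_supp X x' -> mm_d (f x) (f x') = mm_d x x'.

(** An mm-isomorphism is controlled on the support only; a constant value elsewhere makes it a Borel
    map. *)
Definition iso_ext (x : X) : Y := if pselect (@mm_supp X x) then f x else y0.

Lemma iso_ext_meas B : borel (@mm_d Y) B -> borel (@mm_d X) (iso_ext @^-1` B).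
Proof.
have sb := @borel_sigma _ (@mm_d X).
apply: (borel_preimage sb) => U oU.
(* An open set whose trace on the support is the preimage of [U], because [f] is isometric there. *)
pose V := [set x : X | exists x0, exists2 e : Real, mm_d x0 x < e &
   @mm_supp X x0 /\ mball (@mm_d Y) (f x0) e `<=` U].
have oV : mopen (@mm_d X) V.
  move=> x [x0 [e xe [s0 eU]]]; have [r r0 rU] := mopen_ball (mm_metric X) xe.
  by exists r => // z /rU ze; exists x0, e.
rewrite (_ : _ @^-1` _ = (@mm_supp X `&` V) `|` (~` @mm_supp X `&` [set _ | U y0])).
  apply: (saU sb); apply: (saI sb); [exact: supp_borel|exact: mopen_borel| |exact: (sa_const sb)].
  exact: (mopen_borel (supp_open X)).
apply/seteqP; split => x /=; rewrite /iso_ext; case: pselect => sx.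
- move=> /oU [e e0 eU]; left; split => //; exists x, e => //.
  by rewrite (metric_refl (mm_metric X)).
- by right.
- move=> [[_ [x0 [e xe [s0 eU]]]]|[//]]; apply: eU; rewrite /mball /= fiso //.
- by case=> -[].
Qed.

Lemma iso_supp_meas B : borel (@mm_d Y) B -> borel (@mm_d X) (@mm_supp X `&` f @^-1` B).
Proof.
move=> bB; rewrite (_ : _ `&` _ = @mm_supp X `&` iso_ext @^-1` B).
  by apply: (saI (@borel_sigma _ (@mm_d X))); [exact: supp_borel|exact: iso_ext_meas].
by apply/seteqP; split => x [sx]; rewrite /= /iso_ext; case: pselect.
Qed.

End Iso.

Lemma mm_iso_refl (X : mmspace) : mm_iso X X.
Proof.
exists id; split => //; split; first by rewrite image_id.
move=> B bB; rewrite preimage_id.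
exact: muI_supp.
Qed.

Lemma mm_iso_sym (X Y : mmspace) : mm_iso X Y -> mm_iso Y X.
Proof.
move=> [f [fiso [fim fmu]]]; have [x0 _] := mm_point X.
have ex (y : Y) : exists x : X, @mm_supp Y y -> @mm_supp X x /\ f x = y.
  have [ys|] := pselect (@mm_supp Y y); last by exists x0.
  by move: (ys); rewrite -fim => -[x xs xy]; exists x.
pose g y := projT1 (cid (ex y)).
have gP y : @mm_supp Y y -> @mm_supp X (g y) /\ f (g y) = y.
  by rewrite /g; case: cid.
have giso y y' : @mm_supp Y y -> @mm_supp Y y' -> mm_d (g y) (g y') = mm_d y y'.
  by move=> /gP [h1 h2] /gP [h3 h4]; rewrite -fiso // h2 h4.
have fs x : @mm_supp X x -> @mm_supp Y (f x) by move=> xs; rewrite -fim; exists x.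
have gf x : @mm_supp X x -> g (f x) = x.
  move=> xs; have [h1 h2] := gP _ (fs _ xs).
  by apply: (metric_eq (mm_metric X)); rewrite -fiso // h2 (metric_refl (mm_metric Y)).
exists g; split => //; split.
  apply/seteqP; split => x.
    by move=> [y /gP [h1 h2] <-].
  by move=> xs; exists (f x); [exact: fs|exact: gf].
move=> B bB; rewrite -fmu; last exact: (iso_supp_meas x0 giso bB).
rewrite -[RHS](muI_supp bB).
congr mm_mu; apply/seteqP; split => x [xs] /=.
  by rewrite gf // => -[_ ?].
by move=> Bx; split => //; split; [exact: fs|rewrite /= gf].
Qed.

(** A parameter lies in the support at almost every time, and there composing with the isomorphism
    preserves distances. *)
Lemma parameter_iso (X Y : mmspace) (phi : Real -> X) : mm_iso X Y -> parameter phi ->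
  exists (psi : Real -> Y) (J : set Real), [/\ parameter psi, SI J, lam J = 1 &
    forall s t, J s -> J t -> mm_d (psi s) (psi t) = mm_d (phi s) (phi t)].
Proof.
move=> [f [fiso [fim fmu]]] /parameterP ph; have [y0 _] := mm_point Y.
have [SJ LJ] := ph _ (supp_borel X).
exists (iso_ext f y0 \o phi), (phi @^-1` @mm_supp X); split => //.
- apply/parameterP => B bB; have bf := iso_ext_meas y0 fiso bB.
  have [h1 h2] := ph _ bf; split; first exact: h1.
  rewrite -fmu // -[LHS]/(lam (phi @^-1` (iso_ext f y0 @^-1` B))) h2.
  rewrite -[LHS](muI_supp bf).
  by congr mm_mu; apply/seteqP; split => x [sx]; rewrite /= /iso_ext; case: pselect.
- by rewrite LJ supp_full.
- by move=> s t /= Js Jt; rewrite /iso_ext; case: pselect => // ?; case: pselect => // ?; exact: fiso.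
Qed.

Lemma box_cond_iso (X X' Y : mmspace) (eps : Real) :
  mm_iso X X' -> box_cond X Y eps -> box_cond X' Y eps.
Proof.
move=> iso /box_condP [e0 [phi [psi [J [h1 h2 h3 h4 h5]]]]]; apply/box_condP; split => //.
have [phi' [J' [k1 k2 k3 k4]]] := parameter_iso iso h1.
exists phi', psi, (J `&` J'); split => //; first exact: (saI SI_sigma).
  by have := lamI_ge h3 k2; rewrite k3; lra.
by move=> s t s1 t1 [Js Js'] [Jt Jt']; rewrite k4 //; exact: h5.
Qed.

Lemma box_cond_class (A : mmX) (X X' Y : mmspace) (eps : Real) :
  in_class A X -> in_class A X' -> box_cond X Y eps -> box_cond X' Y eps.
Proof.
case: A => A [X0 AE]; rewrite /in_class /= AE => h1 h2 h.
by apply: (box_cond_iso h2); apply: (box_cond_iso _ h); exact: mm_iso_sym.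
Qed.

Definition mmclass (X : mmspace) : mmX :=
  exist _ (mm_iso X) (ex_intro _ X erefl : is_mmclass (mm_iso X)).

Lemma in_mmclass (X : mmspace) : in_class (mmclass X) X.
Proof. exact: mm_iso_refl. Qed.

Lemma class_rep (A : mmX) : exists X, in_class A X.
Proof. by case: A => A [X0 AE]; exists X0; rewrite /in_class /= AE; exact: mm_iso_refl. Qed.

(** At [eps = 1] the empty set of times is admissible, so the infimum defining [box] is over a
    nonempty set. *)
Lemma box_cond_1 (X Y : mmspace) : box_cond X Y 1.
Proof.
have [phi p] := parameter_exists X; have [psi p'] := parameter_exists Y.
apply/box_condP; split; first by lra.
exists phi, psi, set0; split => //; first exact: (sa0 SI_sigma).
by rewrite (pr0 lam_prob); lra.
Qed.

Lemma box_has_inf (A B : mmX) :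
  has_inf [set eps | exists X Y, in_class A X /\ in_class B Y /\ box_cond X Y eps].
Proof.
have [X AX] := class_rep A; have [Y BY] := class_rep B.
split; first by exists 1, X, Y; split => //; split => //; exact: box_cond_1.
by exists 0 => e [? [? [_ [_ []]]]].
Qed.

Lemma box_ge0 (A B : mmX) : 0 <= box A B.
Proof.
apply: lb_le_inf; first by case: (box_has_inf A B).
by move=> e [? [? [_ [_ []]]]].
Qed.

Lemma box_le (A B : mmX) (X Y : mmspace) (eps : Real) :
  in_class A X -> in_class B Y -> box_cond X Y eps -> box A B <= eps.
Proof.
move=> AX BY h; apply: ge_inf; first by case: (box_has_inf A B).
by exists X, Y.
Qed.

Lemma box_lt (A B : mmX) (X Y : mmspace) (e : Real) :
  in_class A X -> in_class B Y -> box A B < e -> exists2 eps, eps < e & box_cond X Y eps.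
Proof.
move=> AX BY h.
have [eps [X' [Y' [AX' [BY' c]]]] ee] := inf_lt (proj1 (box_has_inf A B)) h.
exists eps => //; apply: (box_cond_class AX' AX).
by apply/box_cond_sym/(box_cond_class BY' BY)/box_cond_sym.
Qed.

Lemma box_sym (A B : mmX) : box A B = box B A.
Proof.
rewrite /box; congr inf; apply/seteqP; split => e [X [Y [h1 [h2 h3]]]];
  by exists Y, X; split => //; split => //; exact: box_cond_sym.
Qed.

(** * Gluing parameters; the triangle inequality *)

Definition dR (x y : Real) : Real := `|x - y|.

Lemma dR_metric : is_metric dR.
Proof.
rewrite /dR; split => //; split.
  by move=> x y; split => [/eqP|->]; rewrite ?subrr ?normr0 // normr_eq0 subr_eq0 => /eqP.
by split => [x y|x y z]; [exact: distrC|exact: ler_distD].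
Qed.

Lemma dR_complete : mcomplete dR.
Proof.
move=> u cu.
have [l hl] : exists l, Rseries.Un_cv u l.
  suff /Rcomplete.R_complete [l hl] : Rseries.Cauchy_crit u by exists l.
  move=> e /RltP e0; have [N hN] := cu e e0; exists N => m n mN nN.
  by rewrite RdistE; apply/RltP; apply: hN; apply/ssrnat.leP.
exists l => e e0; have /RltP e0' := e0; have [N hN] := hl e e0'; exists N => n nN.
by have := hN n (elimT ssrnat.leP nN); rewrite RdistE /dR distrC => /RltP.
Qed.

Lemma dR_separable : mseparable dR.
Proof.
exists (fun n => if (unpickle n : option rat) is Some q then ratr q else 0) => x e e0.
have [q] := @rat_in_itvoo Real (x - e) (x + e) ltac:(lra).
rewrite in_itv /= => h; exists (pickle q); rewrite pickleK /dR ltr_norml.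
by apply/andP; split; lra.
Qed.

Lemma borelR_measurable B : borel dR B -> @measurable _ (measurableTypeR Real) B.
Proof.
apply: (@smallest_sub _ _ _ [set B | @measurable _ (measurableTypeR Real) B]).
  split => [|A mA|F mF]; [exact: measurable0|by rewrite setTD; exact: measurableC|].
  exact: bigcupT_measurable.
move=> U oU; apply: (@open_measurable Real); rewrite openE => x /oU [e e0 eU].
by exists e => // y /= xy; apply: eU.
Qed.

Lemma measurable_borelR B : @measurable _ (measurableTypeR Real) B -> borel dR B.
Proof.
rewrite RGenOInfty.measurableE; apply: smallest_sub; first exact: borel_sigma.
move=> A [x ->]; apply: mopen_borel => y /=; rewrite in_itv /= andbT => xy.
exists (y - x); first by lra.
by move=> z; rewrite /mball /= /dR in_itv /= andbT ltr_norml => /andP[_]; lra.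
Qed.

Definition clampI (y : Real) : Real := if 0 <= y < 1 then y else 0.

Lemma clampI_I01 y : I01 (clampI y).
Proof. by apply/I01P; rewrite /clampI; case: ifP => // _; rewrite lexx ltr01. Qed.

Lemma clampI_id y : I01 y -> clampI y = y.
Proof. by move=> /I01P h; rewrite /clampI h. Qed.

Lemma clampI_meas B : SI B -> borel dR (clampI @^-1` B).
Proof.
move=> SB; have sb := @borel_sigma _ dR.
rewrite (_ : _ @^-1` _ = (I01 `&` B) `|` (~` I01 `&` [set _ | B 0])).
  apply: (saU sb); first exact: measurable_borelR.
  apply: (saI sb); last exact: (sa_const sb).
  by apply: (saC sb); apply: measurable_borelR; exact: measurable_I01.
apply/seteqP; split => y /=; rewrite /clampI; case: ifP => h.
- by move=> By; left; split => //; apply/I01P.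
- by move=> B0; right; split => // /I01P; rewrite h.
- by case=> [[]//|[+ _]]; case; apply/I01P.
- by case=> [[/I01P]|[]//]; rewrite h.
Qed.

Lemma CS_shift N E : CS E -> CS [set om | E (fun i => om (N + i)%N)].
Proof.
apply: (@smallest_sub _ _ _ [set E | CS [set om | E (fun i => om (N + i)%N)]]).
  split => [|A|F mF].
  - exact: (sa0 CS_sigma).
  - by rewrite setTD; exact: (saC CS_sigma).
  - rewrite /= (_ : [set om | _] = \bigcup_n [set om | F n (fun i => om (N + i)%N)]).
      exact: (sa_bigcup CS_sigma).
    by apply/seteqP; split => om.
move=> A [->|[w ->]]; first exact: (sa0 CS_sigma).
rewrite /cyl /=.
have := CS_prefix (N + size w) (fun u => mkseq (fun i => nth false u (N + i)) (size w) = w).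
rewrite (_ : [set om | _] = [set om | mkseq (fun i => om (N + i)%N) (size w) = w]) //.
have e (om : nat -> bool) : mkseq (fun i => nth false (mkseq om (N + size w)) (N + i)) (size w) =
    mkseq (fun i => om (N + i)%N) (size w).
  apply: (@eq_from_nth _ false); rewrite !size_mkseq // => i iw.
  by rewrite !nth_mkseq // ltn_add2l.
by apply/seteqP; split => om /=; rewrite e.
Qed.

Section Glue.
Variables (Y : mmspace) (s : nat -> Y) (N : nat) (r : Real) (sR : nat -> Real).
Hypothesis sR_dense : forall x (e : Real), 0 < e -> exists n, dR x (sR n) < e.

Definition glue_dec (om : nat -> bool) : Real :=
  clampI (decode dR_metric dR_complete sR least_hit (fun i => om (N + i)%N)).

Lemma glue_dec_meas B : SI B -> CS (glue_dec @^-1` B).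
Proof.
move=> SB; have mg := decode_meas dR_metric dR_complete sR least_hit_meas (clampI_meas SB).
exact: (@CS_shift N _ mg).
Qed.

Variable psi : Real -> Y.
Hypothesis ppsi : parameter psi.

(** The first [N] bits record which balls about the [s i] contain [psi t]; the remaining ones code
    [t], which is recovered by dropping [N] bits. *)
Definition glue_code (t : Real) (i : nat) : bool :=
  if (i < N)%N then mm_d (s i) (psi t) < r else code dR sR t (i - N).

Lemma glue_code_meas i : SI [set t | glue_code t i].
Proof.
have [iN|iN] := boolP (i < N)%N.
  rewrite (_ : [set t | _] = psi @^-1` mball (@mm_d Y) (s i) r).
    by move/parameterP: ppsi => /(_ _ (borel_ball (mm_metric Y) (s i) r)) [].
  by apply/seteqP; split => t; rewrite /= /glue_code iN.
rewrite (_ : [set t | _] = [set t | code dR sR t (i - N)]).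
  apply: measurableI; first exact: measurable_I01.
  by apply: borelR_measurable; apply: code_borel; exact: dR_metric.
by apply/seteqP; split => t; rewrite /= /glue_code (negbTE iN).
Qed.

Definition glue_quant : Real -> nat -> bool := quant (mass lam glue_code).
Definition glue_map (t : Real) : Real := glue_dec (glue_quant t).

Lemma glue_dec_code t : I01 t -> glue_dec (glue_code t) = t.
Proof.
move=> t1; rewrite /glue_dec (_ : decode _ _ _ _ _ = t); first exact: clampI_id.
apply: decode_code => k.
rewrite (_ : (fun i => _) = code dR sR t).
  exact: (least_hit_code (sR_dense t (halfpow_gt0 k))).
by apply/funext => i; rewrite /glue_code ltnNge leq_addr /= addKn.
Qed.

Lemma glue_quant_law E : CS E ->
  SI (glue_quant @^-1` E) /\ lam (glue_quant @^-1` E) = lam (glue_code @^-1` E).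
Proof. by move=> /(quant_law lam_prob glue_code_meas) []. Qed.

(** The sorted code has the same law as [glue_code], and decoding the latter returns [t]. *)
Lemma glue_map_law B : SI B -> SI (glue_map @^-1` B) /\ lam (glue_map @^-1` B) = lam B.
Proof.
move=> SB; have [h1 h2] := glue_quant_law (glue_dec_meas SB); split => //.
rewrite -[LHS]/(lam (glue_quant @^-1` (glue_dec @^-1` B))) h2.
by apply: lam_ext => t t1 /=; rewrite glue_dec_code.
Qed.

Lemma glue_map_I01 t : I01 (glue_map t). Proof. exact: clampI_I01. Qed.

Definition glue_set : set Real :=
  [set t | forall i, (i < N)%N -> glue_quant t i = (mm_d (s i) (psi (glue_map t)) < r)].

(** Consistency of the first [N] bits with the decoded time is an event of the Cantor space. It
    holds for every [glue_code t], hence almost surely for the sorted code, which has the same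
    law. *)
Lemma glue_set_full : SI glue_set /\ lam glue_set = 1.
Proof.
pose E := [set om | forall i, (i < N)%N -> om i = (mm_d (s i) (psi (glue_dec om)) < r)].
have mE : CS E.
  apply: (sa_forall_lt CS_sigma) => i _.
  pose D := glue_dec @^-1` (psi @^-1` mball (@mm_d Y) (s i) r).
  have mD : CS D.
    by apply: glue_dec_meas; move/parameterP: ppsi => /(_ _ (borel_ball (mm_metric Y) (s i) r)) [].
  rewrite (_ : (fun om => _) = ([set om : nat -> bool | om i] `&` D) `|`
     (~` [set om : nat -> bool | om i] `&` ~` D)).
    apply: (saU CS_sigma); apply: (saI CS_sigma) => //; [exact: CS_bit| |exact: (saC CS_sigma)].
    by apply: (saC CS_sigma); exact: CS_bit.
  apply/seteqP; split => om; rewrite /D /mball /=.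
    by case: (om i) => <-; [left|right].
  case=> -[h1 h2]; first by rewrite h1 h2.
  by rewrite (negbTE (introN idP h1)) (negbTE (introN idP h2)).
have [h1 h2] := glue_quant_law mE; split => //.
rewrite -[glue_set]/(glue_quant @^-1` E) h2 -(prT lam_prob); apply: lam_ext => t t1; split => // _ i iN.
by rewrite glue_dec_code // /glue_code iN.
Qed.

(** The right-hand side does not mention [psi], so [quant_agree] applies to any two parameters of
    [Y]. *)
Lemma glue_code_mass w : (size w <= N)%N ->
  mass lam glue_code w =
  mm_mu [set y | forall i, (i < size w)%N -> (mm_d (s i) y < r) = nth false w i].
Proof.
move=> wN; set C := [set y | _].
have bC : borel (@mm_d Y) C.
  have sb := @borel_sigma _ (@mm_d Y).
  apply: (sa_forall_lt sb) => i _; have bb := borel_ball (mm_metric Y) (s i) r.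
  case: (nth false w i) => /=; first exact: bb.
  rewrite (_ : (fun _ => _) = ~` mball (@mm_d Y) (s i) r); first exact: (saC sb).
  by apply/seteqP; split => y; rewrite /mball /= => /negP; rewrite ?negbK // => /negPf.
have [_ <-] := iffLR (parameterP psi) ppsi _ bC.
rewrite /mass cylE; congr lam; apply/seteqP; split => t /= h i iw;
  by rewrite -h // /glue_code (leq_trans iw).
Qed.

Lemma glue_quant_cover : SI [set t | exists2 i, (i < N)%N & glue_quant t i] /\
  lam [set t | exists2 i, (i < N)%N & glue_quant t i] =
  mm_mu [set y | exists2 i, (i < N)%N & mm_d (s i) y < r].
Proof.
pose E := [set om : nat -> bool | exists2 i, (i < N)%N & om i].
have EE : E = ~` [set om : nat -> bool | forall i, (i < N)%N -> (~` [set om : nat -> bool | om i]) om].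
  apply/seteqP; split => om /=; first by move=> [i iN oi] h; exact: (h i iN).
  move=> h; apply: contrapT => h'; apply: h => i iN oi; apply: h'; by exists i.
have mE : CS E.
  rewrite EE; apply: (saC CS_sigma); apply: (sa_forall_lt CS_sigma) => i _.
  by apply: (saC CS_sigma); exact: CS_bit.
have [h1 h2] := glue_quant_law mE; split => //.
rewrite -[LHS]/(lam (glue_quant @^-1` E)) h2.
set C := [set y | _].
have bC : borel (@mm_d Y) C.
  have sb := @borel_sigma _ (@mm_d Y).
  rewrite (_ : C = ~` [set y | forall i, (i < N)%N -> (~` mball (@mm_d Y) (s i) r) y]).
    apply: (saC sb); apply: (sa_forall_lt sb) => i _; apply: (saC sb).
    exact: (borel_ball (mm_metric Y)).
  apply/seteqP; split => y /=; first by move=> [i iN oi] h; exact: (h i iN).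
  move=> h; apply: contrapT => h'; apply: h => i iN oi; apply: h'; by exists i.
have [_ <-] := iffLR (parameterP psi) ppsi _ bC.
by congr lam; apply/seteqP; split => t [i iN] h; exists i; move: h; rewrite /glue_code ?iN.
Qed.

End Glue.

(* Both parameters are re-sorted by the quantile map of a code whose first [N] bits record
   the small balls hit; these bits have the same law for both, so the sorted codes share them. *)
Lemma gluing (Y : mmspace) (psi psi' : Real -> Y) (eta : Real) :
  parameter psi -> parameter psi' -> 0 < eta ->
  exists (f g : Real -> Real) (J : set Real),
   [/\ forall t, I01 (f t) /\ I01 (g t),
       forall B, SI B -> SI (f @^-1` B) /\ lam (f @^-1` B) = lam B,
       forall B, SI B -> SI (g @^-1` B) /\ lam (g @^-1` B) = lam B,
       SI J /\ 1 - eta <= lam J &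
       forall t, J t -> mm_d (psi (f t)) (psi' (g t)) <= eta].
Proof.
move=> p p' e0; have [s ds] := mm_separable Y; have [sR dsR] := dR_separable.
have e2 : 0 < eta / 2 by lra.
have [N hN] : exists N, 1 - eta < mm_mu [set y | exists2 i, (i < N)%N & mm_d (s i) y < eta / 2].
  apply: (pr_cover (@borel_sigma _ (@mm_d Y)) (mm_is_prob Y) (F := fun i => mball (@mm_d Y) (s i) (eta / 2))) => //.
    by move=> n; exact: (borel_ball (mm_metric Y)).
  by move=> y; have [n hn] := ds y _ e2; exists n; rewrite /mball /= (metric_sym (mm_metric Y)).
pose r := eta / 2.
have agree t i : (i < N)%N -> glue_quant s N r sR psi t i = glue_quant s N r sR psi' t i.
  by apply: quant_agree => w wN; rewrite !glue_code_mass.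
have [c1 c2] := glue_quant_cover s N r sR p.
have [j1 j2] := glue_set_full s N r dsR p.
have [k1 k2] := glue_set_full s N r dsR p'.
(* Good times: the shared bits record some ball and both decoded points agree with them, so both lie
   in one ball of radius [eta / 2]. *)
exists (glue_map s N r sR psi), (glue_map s N r sR psi'),
  ([set t | exists2 i, (i < N)%N & glue_quant s N r sR psi t i] `&`
   (glue_set s N r sR psi `&` glue_set s N r sR psi')); split.
- by move=> t; split; exact: glue_map_I01.
- by move=> B; exact: glue_map_law.
- by move=> B; exact: glue_map_law.
- have jk := saI SI_sigma j1 k1; split; first exact: (saI SI_sigma).
  have := lamI_ge c1 jk; have := lamI_ge j1 k1; rewrite j2 k2 c2; rewrite /r; lra.
- move=> t [[i iN ti] [h1 h2]].
  have := h1 i iN; have := h2 i iN; rewrite -agree // ti => /esym h3 /esym h4.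
  have := metric_tri (mm_metric Y) (psi (glue_map s N r sR psi t)) (s i) (psi' (glue_map s N r sR psi' t)).
  by rewrite [mm_d _ (s i)](metric_sym (mm_metric Y)); move: h3 h4; rewrite /r; lra.
Qed.

Lemma parameter_comp (X : mmspace) (phi : Real -> X) (f : Real -> Real) : parameter phi ->
  (forall B, SI B -> SI (f @^-1` B) /\ lam (f @^-1` B) = lam B) -> parameter (phi \o f).
Proof.
move=> /parameterP p h; apply/parameterP => B bB; have [h1 h2] := p _ bB.
by have [h3 h4] := h _ h1; rewrite comp_preimage h4.
Qed.

(** Gluing brings the two parameters of [Y] within [eta] of each other. The two endpoints of a
    distance cost [2 * eta], and the measure loses [a + b + eta]. *)
Lemma box_cond_tri (X Y Z : mmspace) (a b eta : Real) : box_cond X Y a -> box_cond Y Z b ->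
  0 < eta -> box_cond X Z (a + b + 2 * eta).
Proof.
move=> /box_condP [a0 [phi [psi [I0 [h1 h2 h3 h4 h5]]]]].
move=> /box_condP [b0 [psi' [chi [I1 [k1 k2 k3 k4 k5]]]]] e0.
have [f [g [J [fg hf hg [SJ LJ] hJ]]]] := gluing h2 k1 e0.
apply/box_condP; split; first by lra.
have [f1 f2] := hf _ h3; have [g1 g2] := hg _ k3.
have fg1 := saI SI_sigma f1 g1.
exists (phi \o f), (chi \o g), (J `&` (f @^-1` I0 `&` g @^-1` I1)); split.
- exact: parameter_comp.
- exact: parameter_comp.
- exact: (saI SI_sigma).
- by have := lamI_ge SJ fg1; have := lamI_ge f1 g1; rewrite f2 g2; lra.
move=> s t _ _ [Js [Is Is']] [Jt [It It']] /=.
have [fs gs] := fg s; have [ft gt] := fg t.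
have := h5 _ _ fs ft Is It; have := k5 _ _ gs gt Is' It'; have := hJ _ Js; have := hJ _ Jt.
have t1 := metric_tri (mm_metric Y) (psi (f s)) (psi' (g s)) (psi (f t)).
have t2 := metric_tri (mm_metric Y) (psi' (g s)) (psi' (g t)) (psi (f t)).
have t3 := metric_tri (mm_metric Y) (psi' (g s)) (psi (f s)) (psi' (g t)).
have t4 := metric_tri (mm_metric Y) (psi (f s)) (psi (f t)) (psi' (g t)).
move: t1 t2 t3 t4; rewrite [mm_d (psi' (g t)) (psi (f t))](metric_sym (mm_metric Y)).
rewrite [mm_d (psi' (g s)) (psi (f s))](metric_sym (mm_metric Y)).
move=> t1 t2 t3 t4 u1 u2; rewrite !ler_norml => /andP[u3 u4] /andP[u5 u6].
by apply/andP; split; lra.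
Qed.

Lemma box_tri (A B C : mmX) : box A C <= box A B + box B C.
Proof.
have [X AX] := class_rep A; have [Y BY] := class_rep B; have [Z CZ] := class_rep C.
apply: ler_limP => e e0.
have [a ha ca] : exists2 a, a < box A B + e / 4 & box_cond X Y a by apply: box_lt AX BY _; lra.
have [b hb cb] : exists2 b, b < box B C + e / 4 & box_cond Y Z b by apply: box_lt BY CZ _; lra.
have e8 : 0 < e / 8 by lra.
by have := box_le AX CZ (box_cond_tri ca cb e8); lra.
Qed.

(** * Spaces R^n with the sup metric; monotone codes *)

(* Index types such as ['I_n] live in a universe above the carriers allowed in [mmspace],
   so R^n is modelled by the sequences vanishing from rank [n] on. *)
Definition vec (n : nat) : Set := {f : nat -> Real | forall i, (n <= i)%N -> f i = 0}.

Section SupMetric.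
Variable n : nat.
Implicit Types x y z : vec n.

Definition crd x : nat -> Real := proj1_sig x.

Lemma mkvec_subproof (f : nat -> Real) i : (n <= i)%N -> (if (i < n)%N then f i else 0) = 0.
Proof. by rewrite ltnNge => ->. Qed.

Definition mkvec (f : nat -> Real) : vec n := exist _ _ (mkvec_subproof f).

Lemma crd_mkvec f i : (i < n)%N -> crd (mkvec f) i = f i.
Proof. by rewrite /crd /= => ->. Qed.

Lemma vec_eq x y : (forall i, (i < n)%N -> crd x i = crd y i) -> x = y.
Proof.
case: x y => [f hf] [g hg]; rewrite /crd /= => h; apply: eq_exist; apply/funext => i.
by case: (ltnP i n) => [/h //|ni]; rewrite hf ?hg.
Qed.

Definition dI x y : Real := \big[Num.max/0]_(i < n) `|crd x i - crd y i|.

Lemma dI_ge x y i : (i < n)%N -> `|crd x i - crd y i| <= dI x y.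
Proof.
by move=> iN; exact: (le_bigmax _ (fun i : 'I_n => `|crd x i - crd y i|) (Ordinal iN)).
Qed.

Lemma dI_le x y (c : Real) : 0 <= c ->
  (forall i, (i < n)%N -> `|crd x i - crd y i| <= c) -> dI x y <= c.
Proof. by move=> c0 h; apply: bigmax_le => // i _; exact: h. Qed.

Lemma dI_lt x y (c : Real) : 0 < c ->
  (forall i, (i < n)%N -> `|crd x i - crd y i| < c) -> dI x y < c.
Proof. by move=> c0 h; apply: bigmax_lt => // i _; exact: h. Qed.

Lemma dI_ge0 x y : 0 <= dI x y. Proof. exact: bigmax_ge_id. Qed.

Lemma dI_metric : is_metric dI.
Proof.
split; first exact: dI_ge0.
split => [x y|].
  split => [h|->]; last first.
    by apply: le_anti; rewrite dI_ge0 andbT dI_le // => i _; rewrite subrr normr0.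
  by apply: vec_eq => i iN; apply/eqP; rewrite -subr_eq0 -normr_le0 -h; exact: dI_ge.
split => [x y|x y z]; first by apply: eq_bigr => i _; rewrite distrC.
apply: dI_le => [|i iN]; first by rewrite addr_ge0 ?dI_ge0.
by apply: (le_trans (ler_distD (crd y i) _ _)); apply: lerD; exact: dI_ge.
Qed.

Lemma dI_complete : mcomplete dI.
Proof.
move=> u cu.
have H i : exists l, (i < n)%N -> forall e : Real, 0 < e ->
    exists N : nat, forall k : nat, (N <= k)%N -> dR l (crd (u k) i) < e.
  case: (ltnP i n) => [iN|]; last by exists 0.
  have [l hl] : exists l, forall e : Real, 0 < e ->
      exists N : nat, forall k : nat, (N <= k)%N -> dR l (crd (u k) i) < e.
    apply: (@dR_complete (fun k => crd (u k) i)) => e e0; have [N hN] := cu e e0.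
    by exists N => a b aN bN; apply: le_lt_trans (hN _ _ aN bN); exact: dI_ge.
  by exists l.
pose l i := projT1 (cid (H i)).
have lP (i : 'I_n) : forall e : Real, 0 < e ->
    exists N : nat, forall k : nat, (N <= k)%N -> dR (l i) (crd (u k) i) < e.
  by rewrite /l; case: cid => x /= hx; exact: hx.
exists (mkvec l) => e e0; pose M i := projT1 (cid (lP i e e0)).
have MP i : forall k : nat, (M i <= k)%N -> dR (l i) (crd (u k) i) < e.
  by rewrite /M; case: cid.
exists (\max_i M i) => k hk; apply: dI_lt => // i iN; rewrite crd_mkvec //.
by apply: (MP (Ordinal iN)); apply: leq_trans hk; exact: leq_bigmax.
Qed.

Lemma dI_separable : mseparable dI.
Proof.
exists (fun k => mkvec (fun i => if (unpickle k : option (seq rat)) is Some f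
   then ratr (nth 0 f i) else 0)).
move=> x e e0.
have H i : exists q : rat, crd x i - e < ratr q < crd x i + e.
  have [q] := @rat_in_itvoo Real (crd x i - e) (crd x i + e) ltac:(lra).
  by rewrite in_itv /= => h; exists q.
pose f := mkseq (fun i => projT1 (cid (H i))) n.
exists (pickle f); apply: dI_lt => // i iN; rewrite crd_mkvec // pickleK nth_mkseq //.
by case: cid => q /= /andP[h1 h2]; rewrite ltr_norml; apply/andP; split; lra.
Qed.

Definition in_cube x : Prop := forall i, (i < n)%N -> 0 <= crd x i <= n%:R.

Lemma cube_totally_bounded (s : nat -> vec n) (k : nat) :
  (forall x (e : Real), 0 < e -> exists m, dI x (s m) < e) ->
  exists F : nat, forall x, in_cube x -> exists2 m, (m < F)%N & dI x (s m) < halfpow k.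
Proof.
(* The mesh [h] is half the required radius: rounding down to the grid costs at most [h], and
   passing to a point of the dense sequence less than [h]. *)
move=> ds; set h := halfpow k.+1; have h0 : 0 < h := halfpow_gt0 _.
pose B := Num.trunc (n%:R / h).
pose g (j : {ffun 'I_n -> 'I_B.+1}) : vec n :=
  mkvec (fun i => (if insub i is Some i' then val (j i') else 0%N)%:R * h).
pose f j := projT1 (cid (ds (g j) h h0)).
have fP j : dI (g j) (s (f j)) < h by rewrite /f; case: cid.
exists (\max_j f j).+1 => x xc.
pose j := [ffun i : 'I_n => inord (Num.trunc (crd x i / h)) : 'I_B.+1].
have xg : dI x (g j) <= h.
  apply: dI_le => [|i iN]; first exact: ltW.
  have /andP[x0 xn] := xc i iN; have xh0 : 0 <= crd x i / h by rewrite divr_ge0 // ltW.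
  rewrite /g crd_mkvec // insubT ffunE /= inordK; last first.
    by rewrite ltnS; apply: le_truncn; rewrite ler_pM2r // invr_gt0.
  have /andP[t1 t2] := truncn_itv xh0.
  move: t1 t2; rewrite ler_pdivlMr // ltr_pdivrMr // -natr1 mulrDl mul1r => t1 t2.
  by rewrite ler_norml; apply/andP; split; lra.
exists (f j); first by rewrite ltnS; exact: leq_bigmax.
apply: le_lt_trans (metric_tri dI_metric _ (g j) _) _.
by have := fP j; move: xg; rewrite /h halfpowS; lra.
Qed.

End SupMetric.

(** * Monotone codes are determined by a finite grid *)

Lemma SI_lt (c : Real) : SI [set t | t < c].
Proof.
apply: measurableI; first exact: measurable_I01.
rewrite (_ : [set t | t < c] = `]-oo, c[%classic); first exact: measurable_itv.
by apply/seteqP; split => t; rewrite /= in_itv.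
Qed.

Lemma SI_itv (a b : Real) : SI [set t | a <= t < b].
Proof.
apply: measurableI; first exact: measurable_I01.
rewrite (_ : [set t | _] = `[a, b[%classic); first exact: measurable_itv.
by apply/seteqP; split => t; rewrite /= in_itv.
Qed.

Lemma lam_itv_le (a b : Real) : a <= b -> lam [set t | a <= t < b] <= b - a.
Proof.
move=> ab; rewrite -lee_fin -(lamE (SI_itv a b)).
have E : [set t | a <= t < b] = `[a, b[%classic by apply/seteqP; split => t; rewrite /= in_itv.
apply: (@le_trans _ _ (leb `[a, b[%classic)).
  apply: le_measure; rewrite ?inE; [exact: SI_itv|exact: measurable_itv|].
  by rewrite E; exact: subIsetr.
rewrite /leb lebesgue_measure_itv /= lte_fin -EFinB; case: ifP => // _.
by rewrite lee_fin; lra.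
Qed.

(** By monotonicity the level set meets [0,1) in an interval. *)
Lemma qmono_vcode_SI q k v : qmono q -> SI [set t | vcode (q t) k = v].
Proof.
move=> hq; apply: is_interval_measurable => x y [x1 xv] [y1 yv] z /andP[xz zy].
have z1 : I01 z.
  by move/I01P: x1 => /andP[? ?]; move/I01P: y1 => /andP[? ?]; apply/I01P/andP; split; lra.
split => //=; apply/eqP; rewrite eqn_leq -{1}yv (hq k z y) //= -xv.
exact: (hq k x z).
Qed.

Lemma qmono_bit_SI q i : qmono q -> SI [set t | q t i].
Proof.
move=> hq; rewrite (_ : [set t | _] = [set t | exists v, ([set t | vcode (q t) i.+1 = v] `&` [set _ | odd v]) t]).
  apply: (sa_countU SI_sigma) => v; apply: (saI SI_sigma); last exact: (sa_const SI_sigma).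
  exact: qmono_vcode_SI.
apply/seteqP; split => t /=.
  by move=> qi; exists (vcode (q t) i.+1); split => //=; rewrite oddD oddM /= qi.
by move=> [v [<-]]; rewrite oddD oddM /=; case: (q t i).
Qed.

(** On a cell whose endpoints have equal codes, monotonicity makes both maps constant with the same
    value. Only [2 ^ m] values exist, so at most [2 ^ m] cells of length [1 / M] can be bad. *)
Lemma grid_agree q q' (M m : nat) : qmono q -> qmono q' -> (0 < M)%N ->
  (forall i, (i < M)%N -> vcode (q (i%:R / M%:R)) m = vcode (q' (i%:R / M%:R)) m) ->
  exists J, [/\ SI J, 1 - (2 ^ m)%:R / M%:R <= lam J &
    forall t, J t -> vcode (q t) m = vcode (q' t) m].
Proof.
move=> hq hq' M0 agree.
have M0' : 0 < M%:R :> Real by rewrite ltr0n.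
pose a i := vcode (q (i%:R / M%:R)) m.
have gI i : (i < M)%N -> I01 (i%:R / M%:R).
  by move=> iM; apply/I01P; rewrite divr_ge0 ?ler0n //= ltr_pdivrMr // mul1r ltr_nat.
pose J := [set t | vcode (q t) m = vcode (q' t) m].
have SJ : SI J.
  rewrite (_ : J = [set t | exists v, ([set t | vcode (q t) m = v] `&` [set t | vcode (q' t) m = v]) t]).
    by apply: (sa_countU SI_sigma) => v; apply: (saI SI_sigma); exact: qmono_vcode_SI.
  by apply/seteqP; split => t /=; [move=> ->; exists (vcode (q' t) m)|by move=> [v [h1 h2]]; rewrite /J /= h1 h2].
have SCJ := saC SI_sigma SJ.
pose Bs j := [set t | t < j%:R / M%:R] `&` ~` J.
have SB j : SI (Bs j) by apply: (saI SI_sigma) => //; exact: SI_lt.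
have cell j : [set t : Real | j%:R / M%:R <= t < j.+1%:R / M%:R] =
    [set t | j%:R / M%:R <= t < j%:R / M%:R + M%:R^-1].
  by rewrite -natr1 mulrDl mul1r.
(* Each bad cell raises the integer [a] by at least 1, so [a j] bounds the number of bad cells to
   the left of the [j]-th grid point. *)
have Bj j : (j < M)%N -> lam (Bs j) <= (a j)%:R / M%:R.
  elim: j => [|j ih] jM.
    rewrite (_ : lam (Bs 0%N) = 0) ?divr_ge0 ?ler0n // -(pr0 lam_prob).
    apply: lam_ext => t /I01P /andP[t0 _]; split => //; rewrite /Bs /= mul0r => -[].
    by rewrite ltNge t0.
  have jM' : (j < M)%N by exact: ltnW.
  have aj : (a j <= a j.+1)%N.
    by apply: hq; [exact: gI|exact: gI|rewrite ler_pM2r ?invr_gt0 // ler_nat].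
  move: aj; rewrite leq_eqVlt => /predU1P[aE|alt].
    rewrite -aE (_ : lam (Bs j.+1) = lam (Bs j)); first exact: ih.
    apply: lam_ext => t t1; split => -[/= tj nJ]; split => //=; last first.
      by apply: (lt_le_trans tj); rewrite ler_pM2r ?invr_gt0 // ler_nat.
    rewrite ltNge; apply/negP => jt; apply: nJ; rewrite /J /=.
    have sq (p : Real -> nat -> bool) : qmono p ->
        vcode (p (j%:R / M%:R)) m = a j -> vcode (p (j.+1%:R / M%:R)) m = a j -> vcode (p t) m = a j.
      move=> hp0 e1 e2; have l1 := hp0 m _ _ t1 (gI _ jM) (ltW tj).
      have l2 := hp0 m _ _ (gI _ jM') t1 jt.
      by apply/eqP; rewrite eqn_leq -{1}e2 l1 -e1 l2.
    by transitivity (a j); [exact: sq|apply/esym/sq => //; rewrite -agree].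
  have -> : lam (Bs j.+1) = lam (Bs j `|` ([set t | j%:R / M%:R <= t < j.+1%:R / M%:R] `&` ~` J)).
    apply: lam_ext => t t1; rewrite /Bs /=; split.
      by move=> [tj nJ]; case: (ltP t (j%:R / M%:R)) => h; [left|right; rewrite tj].
    case=> [[tj nJ]|[/andP[_ ?] //]]; split => //.
    by apply: (lt_le_trans tj); rewrite ler_pM2r ?invr_gt0 // ler_nat.
  apply: (le_trans (prU_le SI_sigma lam_prob (SB j) (saI SI_sigma (SI_itv _ _) SCJ))).
  have h1 : lam ([set t | j%:R / M%:R <= t < j.+1%:R / M%:R] `&` ~` J) <= M%:R^-1.
    apply: (@le_trans _ _ (lam [set t | j%:R / M%:R <= t < j.+1%:R / M%:R])).
      apply: (pr_le SI_sigma lam_prob); [exact: (saI SI_sigma (SI_itv _ _) SCJ)|exact: SI_itv|].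
      exact: subIsetl.
    rewrite cell; apply: (le_trans (lam_itv_le _)); last by rewrite addrC addKr.
    by rewrite lerDl invr_ge0 ler0n.
  have h2 : (a j)%:R / M%:R + M%:R^-1 <= (a j.+1)%:R / M%:R :> Real.
    by rewrite -{2}[M%:R^-1]mul1r -mulrDl ler_pM2r ?invr_gt0 // natr1 ler_nat.
  by move: (ih jM') h1 h2; lra.
exists J; split => //.
(* The last cell has no grid point at its right end and is counted as bad; this extra cell is
   absorbed by [a M' < 2 ^ m]. *)
have [M' ME] : exists M', M = M'.+1 by exists M.-1; rewrite prednK.
have h1 : lam (Bs M') <= (a M')%:R / M%:R by apply: Bj; rewrite ME.
have h2 : lam (~` J) <= lam (Bs M') + M%:R^-1.
  have -> : lam (~` J) = lam (Bs M' `|` ([set t | M'%:R / M%:R <= t < M'.+1%:R / M%:R] `&` ~` J)).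
    apply: lam_ext => t /I01P /andP[_ t1]; rewrite /Bs /=; split; last by case=> -[].
    move=> nJ; case: (ltP t (M'%:R / M%:R)) => h; [by left|right].
    by rewrite -ME divff ?t1 // gt_eqF.
  apply: (le_trans (prU_le SI_sigma lam_prob (SB M') (saI SI_sigma (SI_itv _ _) SCJ))).
  rewrite lerD2l; apply: (@le_trans _ _ (lam [set t | M'%:R / M%:R <= t < M'.+1%:R / M%:R])).
    apply: (pr_le SI_sigma lam_prob); [exact: (saI SI_sigma (SI_itv _ _) SCJ)|exact: SI_itv|].
    exact: subIsetl.
  rewrite cell; apply: (le_trans (lam_itv_le _)); last by rewrite addrC addKr.
  by rewrite lerDl invr_ge0 ler0n.
have h3 : (a M')%:R / M%:R + M%:R^-1 <= (2 ^ m)%:R / M%:R :> Real.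
  rewrite -{2}[M%:R^-1]mul1r -mulrDl ler_pM2r ?invr_gt0 // natr1 ler_nat.
  exact: vcode_lt.
by move: h2; rewrite (prC SI_sigma lam_prob SJ); lra.
Qed.

(** * Laws on cubes *)

Lemma push_prob (Y : Type) (d : Y -> Y -> Real) (f : Real -> Y) :
  (forall B, borel d B -> SI (f @^-1` B)) ->
  borel_probability d (fun B => lam (f @^-1` B)).
Proof.
move=> mf; split; first by move=> B /mf; exact: (pr_ge0 lam_prob).
split; first by rewrite preimage_set0 (pr0 lam_prob).
split; first by rewrite preimage_setT (prT lam_prob).
move=> F bF tF; rewrite preimage_bigcup.
have [_ _ _ _ h] := lam_prob; apply: h => [n|]; first exact: (mf _ (bF n)).
apply/trivIsetP => i j _ _ ij; move/trivIsetP: tF => /(_ i j I I ij) Fij.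
by rewrite -preimage_setI Fij preimage_set0.
Qed.

Section CubeSpaces.
Variable n : nat.

Definition cube_s : nat -> vec n := projT1 (cid (@dI_separable n)).

Lemma cube_s_dense x (e : Real) : 0 < e -> exists k, dI x (cube_s k) < e.
Proof. by rewrite /cube_s; case: cid => s /= h; exact: h. Qed.

Definition cube_F (k : nat) : nat := projT1 (cid (cube_totally_bounded k cube_s_dense)).

Lemma cube_FP k x : in_cube x -> exists2 m, (m < cube_F k)%N & dI x (cube_s m) < halfpow k.
Proof. by rewrite /cube_F; case: cid => F /= h; exact: h. Qed.

Definition cube_decode : (nat -> bool) -> vec n :=
  decode (@dI_metric n) (@dI_complete n) cube_s (bounded_hit cube_F).

Lemma cube_decode_code x : in_cube x -> cube_decode (code (@dI n) cube_s x) = x.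
Proof. by move=> xc; apply: decode_code => k; exact: (bounded_hit_code (cube_FP k xc)). Qed.

Lemma cube_decode_meas B : borel (@dI n) B -> CS (cube_decode @^-1` B).
Proof. exact: (decode_meas (@dI_metric n) (@dI_complete n) cube_s (bounded_hit_meas cube_F)). Qed.

Lemma cube_param_meas q : qmono q -> forall B, borel (@dI n) B -> SI ((cube_decode \o q) @^-1` B).
Proof.
move=> hq B /cube_decode_meas mB.
by have [_ h _] := quant_law lam_prob (fun i => qmono_bit_SI i hq) mB.
Qed.

Definition cubeMM q (hq : qmono q) : mmspace :=
  MMSpace (@dI_metric n) (@dI_complete n) (@dI_separable n) (push_prob (cube_param_meas hq)).

Lemma cubeMM_param q (hq : qmono q) : @parameter (cubeMM hq) (cube_decode \o q).
Proof. by apply/parameterP => B bB; split => //; exact: (cube_param_meas hq). Qed.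

(** Agreement on the grid gives equal first [m] bits off a set of measure at most [e], hence decoded
    points within [8 * halfpow k] at each of two times. This is total boundedness of the laws,
    expressed by finite data. *)
Lemma cube_close (e : Real) : 0 < e -> exists m M : nat, forall q q' (hq : qmono q) (hq' : qmono q'),
  (forall i, (i < M)%N -> vcode (q (i%:R / M%:R)) m = vcode (q' (i%:R / M%:R)) m) ->
  box_cond (cubeMM hq) (cubeMM hq') e.
Proof.
move=> e0; have [k hk] : exists k, 16 * halfpow k < e by apply: halfpow_lt => //; lra.
have [m hm] := bounded_hit_prefix cube_F k.
pose M := (Num.trunc ((2 ^ m)%:R / e)).+1.
exists m, M => q q' hq hq' agree.
have [J [SJ LJ hJ]] := grid_agree hq hq' (ltn0Sn _) agree.
apply/box_condP; split; first exact: ltW.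
exists (cube_decode \o q), (cube_decode \o q'), J; split => //; try exact: cubeMM_param.
  apply: le_trans LJ; rewrite lerD2l lerN2 ler_pdivrMr ?ltr0n //.
  rewrite mulrC -ler_pdivrMr //; apply: ltW; exact: truncnS_gt.
move=> s t _ _ /hJ /vcode_inj /hm hs /hJ /vcode_inj /hm ht.
have := decode_agree (@dI_metric n) (@dI_complete n) cube_s hs.
have := decode_agree (@dI_metric n) (@dI_complete n) cube_s ht.
rewrite -/cube_decode /= => d1 d2.
have t1 := metric_tri (@dI_metric n) (cube_decode (q s)) (cube_decode (q' s)) (cube_decode (q t)).
have t2 := metric_tri (@dI_metric n) (cube_decode (q' s)) (cube_decode (q' t)) (cube_decode (q t)).
have t3 := metric_tri (@dI_metric n) (cube_decode (q' s)) (cube_decode (q s)) (cube_decode (q' t)).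
have t4 := metric_tri (@dI_metric n) (cube_decode (q s)) (cube_decode (q t)) (cube_decode (q' t)).
move: t1 t2 t3 t4; rewrite [dI (cube_decode (q' t)) (cube_decode (q t))](metric_sym (@dI_metric n)).
rewrite [dI (cube_decode (q' s)) (cube_decode (q s))](metric_sym (@dI_metric n)).
by move=> t1 t2 t3 t4; rewrite ler_norml; apply/andP; split; lra.
Qed.

(** The code of [G z] has a monotone quantile map, and decoding inverts coding on the cube, so this
    map realises the image law. *)
Lemma cube_law (Z : mmspace) (G : Z -> vec n) :
  (forall z z', dI (G z) (G z') <= mm_d z z') -> (forall z, in_cube (G z)) ->
  exists q (hq : qmono q), forall B, borel (@dI n) B ->
    borel (@mm_d Z) (G @^-1` B) /\ mm_mu (G @^-1` B) = @mm_mu (cubeMM hq) B.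
Proof.
move=> Glip Gc.
have mG : forall B, borel (@dI n) B -> borel (@mm_d Z) (G @^-1` B).
  apply: (borel_preimage (@borel_sigma _ (@mm_d Z))) => U oU; apply: mopen_borel => z /oU.
  move=> [e e0 eU]; exists e => // z' zz'; apply: eU; rewrite /mball /=.
  exact: (le_lt_trans (Glip z z')).
pose b z := code (@dI n) cube_s (G z).
have mb i : borel (@mm_d Z) [set z | b z i].
  exact: (mG _ (code_borel cube_s i (@dI_metric n))).
exists (quant (mass (@mm_mu Z) b)), (quant_mono _) => B bB; split; first exact: mG.
have [_ _ h] := quant_law (mm_is_prob Z) mb (cube_decode_meas bB).
rewrite /= -[RHS]/(lam (quant (mass (@mm_mu Z) b) @^-1` (cube_decode @^-1` B))) h.
by congr mm_mu; apply/seteqP; split => z /=; rewrite cube_decode_code.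
Qed.

End CubeSpaces.

Definition cube_laws (n : nat) : set mmX :=
  [set A | exists q (hq : qmono q), A = mmclass (cubeMM n hq)].

Definition grid_data := (nat * nat * nat * seq nat)%type.

Definition has_data (D : grid_data) (A : mmX) : Prop :=
  let: (n, m, M, l) := D in
  exists q (hq : qmono q), A = mmclass (cubeMM n hq) /\
    [seq vcode (q (i%:R / M%:R)) m | i <- iota 0 M] = l.

Lemma cst_mono : qmono (fun=> fun=> false). Proof. by []. Qed.

(** One class is chosen for each realised grid datum; by [cube_close] the datum determines the class
    up to a small box distance. Other indices receive a default. *)
Definition dense_seq (j : nat) : mmX :=
  let default := mmclass (cubeMM 0 cst_mono) in
  if (unpickle j : option grid_data) is Some D then
    (if pselect (exists A, has_data D A) is left h then projT1 (cid h) else default)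
  else default.

Lemma dense_seq_cube_laws n A (e : Real) : cube_laws n A -> 0 < e -> exists j, box A (dense_seq j) <= e.
Proof.
move=> [q [hq AE]] e0; have [m [M h]] := cube_close n e0.
pose D : grid_data := (n, m, M, [seq vcode (q (i%:R / M%:R)) m | i <- iota 0 M]).
exists (pickle D); rewrite /dense_seq pickleK.
case: pselect => [ex|]; last by case; exists A, q, hq.
case: cid => A' /= [q' [hq' [-> E]]]; rewrite AE.
apply: (box_le (in_mmclass _) (in_mmclass _)); apply: h => i iM.
have := congr1 (fun l => nth 0%N l i) E.
by rewrite !(nth_map 0%N) ?size_iota // !nth_iota //= add0n => ->.
Qed.

(** Truncated distances to finitely many points form a 1-Lipschitz map to a cube that nearly keeps
    distances between points close to them. The points are chosen in the space close to [A], but [n]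
    and [delta] depend on [A] and [e] only. *)
Lemma approx_by_cube_laws (A : mmX) (e : Real) : 0 < e -> exists n (delta : Real), 0 < delta /\
  forall C, box A C < delta -> exists Y, [/\ cube_laws n Y, lip_dom Y C & box A Y <= e].
Proof.
move=> e0; have [X AX] := class_rep A; have [x ds] := mm_separable X.
pose eta := e / 6; have eta0 : 0 < eta by rewrite /eta; lra.
have dm := mm_metric X.
have [N hN] : exists N, 1 - eta < mm_mu [set y | exists2 i, (i < N)%N & mm_d (x i) y < eta].
  apply: (pr_cover (@borel_sigma _ (@mm_d X)) (mm_is_prob X) (F := fun i => mball (@mm_d X) (x i) eta)) => //.
    by move=> n; exact: (borel_ball dm).
  by move=> y; have [n hn] := ds y _ eta0; exists n; rewrite /mball /= (metric_sym dm).
set C := [set y | _] in hN.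
have bC : borel (@mm_d X) C.
  have sb := @borel_sigma _ (@mm_d X).
  rewrite (_ : C = \bigcup_i (mball (@mm_d X) (x i) eta `&` [set _ | (i < N)%N])).
    by apply: (sa_bigcup sb) => i; apply: (saI sb); [exact: (borel_ball dm)|exact: (sa_const sb)].
  apply/seteqP; split => y; first by move=> [i iN h]; exists i.
  by move=> [i _ [h iN]]; exists i.
pose diam := \big[Num.max/0]_(p : 'I_N * 'I_N) mm_d (x p.1) (x p.2).
have diamP i j : (i < N)%N -> (j < N)%N -> mm_d (x i) (x j) <= diam.
  move=> iN jN; pose p : 'I_N * 'I_N := (Ordinal iN, Ordinal jN).
  exact: (le_bigmax _ (fun p : 'I_N * 'I_N => mm_d (x p.1) (x p.2)) p).
(* At least [N] coordinates, and a truncation level above every distance between points of [C]. *)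
pose n := maxn N (Num.trunc (diam + 2 * eta)).+1.
have nN : (N <= n)%N by exact: leq_maxl.
have nD : diam + 2 * eta <= n%:R.
  apply: (@le_trans _ _ (Num.trunc (diam + 2 * eta)).+1%:R); first exact/ltW/truncnS_gt.
  by rewrite ler_nat leq_maxr.
exists n, eta; split => // B AB; have [Z BZ] := class_rep B.
have [eps epse /box_condP [eps0 [phi [psi [J [h1 h2 h3 h4 h5]]]]]] := box_lt AX BZ AB.
have [z0 _] := mm_point Z; have zm := mm_metric Z.
(* The counterpart of [x i] in [Z] is the [psi]-image of a good time at which [phi] is near [x i];
   an arbitrary point replaces it if there is none. *)
have exz (i : nat) : exists z : Z, (exists s, [/\ I01 s, J s & mm_d (x i) (phi s) < eta]) ->
    exists s, [/\ I01 s, J s, mm_d (x i) (phi s) < eta & z = psi s].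
  have [[s [s1 s2 s3]]|h] := pselect (exists s, [/\ I01 s, J s & mm_d (x i) (phi s) < eta]).
    by exists (psi s) => _; exists s.
  by exists z0.
pose zz i := projT1 (cid (exz i)).
have zzP i : (exists s, [/\ I01 s, J s & mm_d (x i) (phi s) < eta]) ->
    exists s, [/\ I01 s, J s, mm_d (x i) (phi s) < eta & zz i = psi s].
  by rewrite /zz; case: cid.
pose G (z : Z) : vec n := mkvec n (fun i => Num.min (mm_d (zz i) z) n%:R).
have Gc z : in_cube (G z).
  move=> i iN'; rewrite /G crd_mkvec // ge_min lexx orbT andbT le_min ler0n andbT; exact: (metric_ge0 zm).
have Glip z z' : dI (G z) (G z') <= mm_d z z'.
  apply: dI_le => [|i iN']; first exact: (metric_ge0 zm).
  have t1 := metric_tri zm (zz i) z z'; have t2 := metric_tri zm (zz i) z' z.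
  move: t2; rewrite [mm_d z' z](metric_sym zm) => t2; have := metric_ge0 zm z z'.
  rewrite /G !crd_mkvec // ler_norml => d0; apply/andP.
  by case: (leP (mm_d (zz i) z) n%:R); case: (leP (mm_d (zz i) z') n%:R); split; lra.
have [q [hq law]] := cube_law Glip Gc.
exists (mmclass (cubeMM n hq)); split; first by exists q, hq.
  exists Z, (cubeMM n hq), G; split => //; split; first exact: in_mmclass.
  by split => // S /law [].
apply: (box_le AX (in_mmclass _)); apply/box_condP; split; first exact: ltW.
have [SC LC] := iffLR (parameterP phi) h1 _ bC.
exists phi, (G \o psi), (J `&` phi @^-1` C); split => //.
- apply/parameterP => S bS; have [l1 l2] := law _ bS.
  by have [p1 p2] := iffLR (parameterP psi) h2 _ l1; rewrite comp_preimage p2 l2.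
- exact: (saI SI_sigma).
- have := lamI_ge h3 SC; rewrite LC; move: hN h4 epse; rewrite /eta; lra.
move=> s t s1 t1 [Js [i iN is_]] [Jt [j jN jt]].
(* Coordinate [i], whose centre is near [psi s], bounds the image distance from below: it is under
   [3 * eta] at [s] and, up to truncation, loses at most [3 * eta] at [t]. Hence [e = 6 * eta]. *)
have [s' [s'1 Js' s'x zE]] : exists s, [/\ I01 s, J s, mm_d (x i) (phi s) < eta & zz i = psi s].
  by apply: zzP; exists s.
have u1 := h5 _ _ s1 t1 Js Jt; have u2 := h5 _ _ s'1 s1 Js' Js; have u3 := h5 _ _ s'1 t1 Js' Jt.
have v1 := Glip (psi s) (psi t).
have iN' := leq_trans iN nN; have v2 := dI_ge (G (psi s)) (G (psi t)) iN'.
have w1 := metric_tri dm (phi s') (x i) (phi s).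
have w2 := metric_tri dm (phi s) (phi s') (phi t).
have w3 := metric_tri dm (phi s) (x i) (phi t); have w4 := metric_tri dm (x i) (x j) (phi t).
have w5 := diamP i j iN jN.
move: u1 u2 u3 v1 v2 w1 w2 w3 w4; rewrite {2 3}/G !crd_mkvec // zE /=.
rewrite [mm_d (phi s') (x i)](metric_sym dm) [mm_d (phi s) (x i)](metric_sym dm).
rewrite [mm_d (phi s) (phi s')](metric_sym dm).
have p1 := metric_ge0 dm (phi s) (phi t).
rewrite !ler_norml => /andP[a1 a2] /andP[a3 a4] /andP[a5 a6] b1 /andP[b2 b3] w1 w2 w3 w4.
have -> : e = 6 * eta by rewrite /eta; lra.
move: b2 b3; case: (leP (mm_d (psi s') (psi s)) n%:R); case: (leP (mm_d (psi s') (psi t)) n%:R).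
all: by move=> c1 c2 b2 b3; apply/andP; split; lra.
Qed.

(** * Hit-and-miss neighbourhoods and the embedding *)

Lemma box_refl (A : mmX) : box A A = 0.
Proof.
have [X AX] := class_rep A; apply: le_anti; rewrite box_ge0 andbT.
exact: (box_le AX AX (box_cond_refl X (lexx 0))).
Qed.

Lemma dense_seqP (A : mmX) (e : Real) : 0 < e -> exists j, box A (dense_seq j) < e.
Proof.
move=> e0; have e3 : 0 < e / 3 by lra.
have [n [delta [d0 h]]] := approx_by_cube_laws A e3.
have [|Y [KY _ AY]] := h A; first by rewrite box_refl.
have [j hj] := dense_seq_cube_laws KY e3; exists j.
by have := box_tri A Y (dense_seq j); lra.
Qed.

Section BoxToSet.
Variables (A : mmX) (S : set mmX).
Hypothesis S0 : S !=set0.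

Lemma box_to_set_has_inf : has_inf [set box A B | B in S].
Proof.
split; first by case: S0 => B SB; exists (box A B), B.
by exists 0 => _ [B _ <-]; exact: box_ge0.
Qed.

Lemma box_to_set_ge (c : Real) : (forall B, S B -> c <= box A B) -> c <= box_to_set A S.
Proof.
move=> h; apply: lb_le_inf; first by case: box_to_set_has_inf.
by move=> _ [B SB <-]; exact: h.
Qed.

Lemma box_to_set_ge0 : 0 <= box_to_set A S.
Proof. by apply: box_to_set_ge => B _; exact: box_ge0. Qed.

Lemma box_to_set_le B : S B -> box_to_set A S <= box A B.
Proof.
by move=> SB; apply: ge_inf; [case: box_to_set_has_inf|exists B].
Qed.

Lemma box_to_set_lt (e : Real) : box_to_set A S < e -> exists2 B, S B & box A B < e.
Proof.
move=> h; have [_ [B SB <-] Be] := inf_lt (proj1 box_to_set_has_inf) h.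
by exists B.
Qed.

End BoxToSet.

Lemma limn_einf_gt0P (u : nat -> Real) : (0 < limn_einf (fun n => (u n)%:E))%E <->
  exists (c : Real) (N : nat), 0 < c /\ forall n, (N <= n)%N -> c <= u n.
Proof.
set v := fun n => (u n)%:E.
have -> : limn_einf v = ereal_sup (range (einfs v)).
  by rewrite limn_einf_lim; apply/cvg_lim => //; exact: cvg_einfs_sup.
rewrite /v; split.
  move=> /ereal_sup_gt [_ [N _ <-]] h.
  have hu n : (N <= n)%N -> (einfs (fun n => (u n)%:E) N <= (u n)%:E)%E.
    by move=> Nn; apply: ereal_inf_lbound; exists n.
  have fe : einfs (fun n => (u n)%:E) N \is a fin_num.
    rewrite ge0_fin_numE; last exact: ltW.
    by apply: (le_lt_trans (hu N (leqnn N))); exact: ltry.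
  exists (fine (einfs (fun n => (u n)%:E) N)), N; split.
    by rewrite -lte_fin fineK.
  by move=> n Nn; rewrite -lee_fin fineK // hu.
move=> [c [N [c0 h]]]; apply: (@lt_le_trans _ _ c%:E); first by rewrite lte_fin.
apply: (@le_trans _ _ (einfs (fun n => (u n)%:E) N)); last by apply: ereal_sup_ubound; exists N.
by apply: le_ereal_inf_tmp => _ [n /= Nn <-]; rewrite lee_fin; exact: h.
Qed.

(** * Openness tested on nets, and weak convergence as Kuratowski-Painleve convergence *)

Definition net_open (V : set FX) : Prop := forall (D : directed_set) (a : D -> FX) (A : FX),
  KP_cvg a A -> V A -> residually (fun l => V (a l)).

Lemma residuallyI (D : directed_set) (P Q : D -> Prop) :
  residually P -> residually Q -> residually (fun l => P l /\ Q l).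
Proof.
move=> [i hi] [j hj]; have [k [ik jk]] := ds_up i j; exists k => l kl.
by split; [apply: hi|apply: hj]; exact: ds_trans kl.
Qed.

Lemma residually_imp (D : directed_set) (P Q : D -> Prop) :
  (forall l, P l -> Q l) -> residually P -> residually Q.
Proof. by move=> PQ [i hi]; exists i => j /hi /PQ. Qed.

Lemma residually_all (D : directed_set) (P : D -> Prop) : (forall l, P l) -> residually P.
Proof. by move=> h; have [i] := ds_inhab D; exists i. Qed.

(** The family [net_open] is itself a compatible topology. *)
Lemma net_open_tauK V : net_open V -> tauK_open V.
Proof.
move=> oV; exists net_open; split => //; split; last first.
  by move=> D a A aA U oU UA; exact: oU aA UA.
split; first by move=> D a A _ _; exact: residually_all.
split; first by move=> D a A _ [].
split.
  move=> F oF D a A aA [U FU UA]; have := oF _ FU _ _ _ aA UA.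
  by apply: residually_imp => l Ul; exists U.
move=> U W oU oW D a A aA [UA WA].
exact: (residuallyI (oU _ _ _ aA UA) (oW _ _ _ aA WA)).
Qed.

Definition nat_directed : directed_set.
Proof.
apply: (@DirectedSet nat (fun m n => (m <= n)%N)).
- exact: leqnn.
- by move=> i j k; exact: leq_trans.
- exact: (inhabits 0%N).
- by move=> i j; exists (maxn i j); rewrite leq_maxl leq_maxr.
Defined.

(** The first half of weak convergence puts the limit inside [Li]; the second keeps [Ls] inside the
    limit. Always [Li] is contained in [Ls]. *)
Lemma weak_cvg_KP (Pn : nat -> Pi) (P : Pi) : weak_cvg Pn P ->
  @KP_cvg nat_directed (fun n => pyr_incl (Pn n)) (pyr_incl P).
Proof.
move=> [lo up]; have ne n : proj1_sig (Pn n) !=set0 by case: (Pn n) => S [].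
pose a : nat_directed -> FX := fun n => pyr_incl (Pn n).
have PLi : proj1_sig P `<=` Li a.
  move=> A /lo /Rcvg_distP h N [e e0 eN]; have [M hM] := h e e0; exists M => n Mn.
  have := hM n Mn; rewrite sub0r normrN ger0_norm; last exact: box_to_set_ge0.
  by move=> /(box_to_set_lt (ne n)) [B PB /eN NB]; exists B.
have LiLs : Li a `<=` Ls a.
  move=> A h N /h [i hi] j; exists (maxn i j); split; first exact: leq_maxr.
  exact/hi/leq_maxl.
have LsP : Ls a `<=` proj1_sig P.
  move=> A h; apply: contrapT => /up /limn_einf_gt0P [c [M [c0 hM]]].
  have [|n [Mn [B PB Bc]]] := h [set B | box A B < c] _ M; first by exists c.
  have := hM n Mn; rewrite leNgt => /negP; apply.
  by apply: le_lt_trans Bc; exact: box_to_set_le.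
by split; apply/seteqP; split => // A; [move=> /LiLs /LsP|move=> /PLi /LiLs].
Qed.

Lemma tauK_weak_open V : tauK_open V -> weak_open (pyr_incl @^-1` V).
Proof.
move=> [T [[_ cT] TV]] P Pn VP /weak_cvg_KP /cT /(_ V TV VP) [N hN].
by exists N => n Nn; exact: hN.
Qed.

Definition hit (i p : nat) (A : set mmX) : Prop :=
  exists2 y, A y & box (dense_seq i) y < halfpow p.

(** With [hit], a subbasis of Fell type: [A] avoids the part of a closed box ball that lies in the
    compact family [cube_laws n]. *)
Definition miss (i n p : nat) (A : set mmX) : Prop :=
  forall y, A y -> cube_laws n y -> halfpow p < box (dense_seq i) y.

(** A point of the limit in the open ball belongs to [Li], so residually the net has points close
    enough to stay in the ball. *)
Lemma hit_net_open i p : net_open [set A | hit i p (proj1_sig A)].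
Proof.
move=> D a A [aLi _] [y Ay yp]; move: Ay; rewrite -aLi => /(_ [set B | box y B < halfpow p - box (dense_seq i) y]).
case; first by exists (halfpow p - box (dense_seq i) y) => //; lra.
move=> l hl; exists l => j /hl [z az yz]; exists z => //.
by have := box_tri (dense_seq i) y z; move: yz => /=; lra.
Qed.

Section UltraLimit.
Variable G : set_system (Real -> nat -> bool).
Hypothesis UG : UltraFilter G.
Hypothesis Gmono : G [set q | qmono q].

(** The pointwise limit of the codes along [G]; as a bit has two values, it always exists. *)
Definition ulim (s : Real) (i : nat) : bool := `[< G [set q | q s i] >].

Lemma ulim_vcode s k : G [set q | vcode (q s) k = vcode (ulim s) k].
Proof.
elim: k => [|k ih]; first by apply: filterS filterT.
have bit : G [set q | q s k = ulim s k].
  rewrite /ulim; case: asboolP => h; first by apply: filterS h => q.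
  have [//|] := in_ultra_setVsetC [set q : Real -> nat -> bool | q s k] UG.
  by apply: filterS => q /= /negP /negbTE.
by apply: filterS (filterI ih bit) => q /= [-> ->].
Qed.

Lemma ulim_mono : qmono ulim.
Proof.
move=> k s t s1 t1 st.
have [q [[/= <- <-]]] := filter_ex (filterI (filterI (ulim_vcode s k) (ulim_vcode t k)) Gmono).
by apply.
Qed.

Lemma ulim_grid m (f : nat -> Real) M :
  G [set q | forall i, (i < M)%N -> vcode (q (f i)) m = vcode (ulim (f i)) m].
Proof.
elim: M => [|M ih]; first by apply: filterS filterT.
apply: filterS (filterI ih (ulim_vcode (f M) m)) => q /= [h1 h2] i.
by rewrite ltnS leq_eqVlt => /predU1P[->|/h1].
Qed.

End UltraLimit.

(* [cube_laws n] is compact: an ultrafilter on the codes met cofinally has a limit code. *)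
Lemma miss_net_open i n p : net_open [set A | miss i n p (proj1_sig A)].
Proof.
move=> D a A [_ aLs] hA; apply: contrapT => nres.
pose W (j : D) (q : Real -> nat -> bool) := exists hq : qmono q,
  proj1_sig (a j) (mmclass (cubeMM n hq)) /\ box (dense_seq i) (mmclass (cubeMM n hq)) <= halfpow p.
have cof l : exists2 j, ds_le l j & exists q, W j q.
  apply: contrapT => h; apply: nres; exists l => j lj y ay [q [hq yE]].
  rewrite ltNge; apply/negP => yp; apply: h; exists j => //; exists q, hq.
  by rewrite -yE.
(* The filter of tails of violating codes, proper because violations occur cofinally. *)
pose F : set_system (Real -> nat -> bool) :=
  [set S | exists l, forall j, ds_le l j -> forall q, W j q -> S q].
have FF : ProperFilter F.
  apply: Build_ProperFilter_ex.
    by move=> S [l hl]; have [j lj [q Wq]] := cof l; exists q; exact: hl lj _ Wq.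
  split.
  - by have [l] := ds_inhab D; exists l.
  - move=> S T [l hl] [l' hl']; have [k [lk l'k]] := ds_up l l'; exists k => j kj q Wq.
    by split; [apply: (hl j) => //|apply: (hl' j) => //]; exact: ds_trans kj.
  - by move=> S T ST [l hl]; exists l => j lj q Wq; apply: ST; exact: hl lj _ Wq.
have [G [UG FG]] := ultraFilterLemma FF.
have Gmono : G [set q | qmono q].
  by apply: FG; have [l] := ds_inhab D; exists l => j _ q [hq _].
pose Y := mmclass (cubeMM n (ulim_mono UG Gmono)).
(* Beyond any [l], some violating code agrees with the limit code on the grid that [cube_close]
   requires. Hence [Y] is in [Ls] and in the closed ball, against [hA]. *)
have near (e : Real) l : 0 < e -> exists2 j, ds_le l j & exists2 y, proj1_sig (a j) y &
    box (dense_seq i) y <= halfpow p /\ box Y y <= e.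
  move=> e0; have [m [M close]] := cube_close n e0.
  have Gl : G [set q | exists2 j, ds_le l j & W j q].
    by apply: FG; exists l => j lj q Wq; exists j.
  have [q [/= agree [j lj [hq [aq qp]]]]] :=
    filter_ex (filterI (ulim_grid UG m (fun i => i%:R / M%:R) M) Gl).
  exists j => //; exists (mmclass (cubeMM n hq)) => //; split => //.
  apply: (box_le (in_mmclass _) (in_mmclass _)); apply: close => k kM.
  by rewrite -agree.
have AY : proj1_sig A Y.
  rewrite -aLs => N [e e0 eN] l; have e2 : 0 < e / 2 by lra.
  have [j lj [y ay [_ yY]]] := near _ l e2; exists j; split => //; exists y => //.
  by apply: eN => /=; lra.
have := hA Y AY; rewrite ltNge => /(_ _) /negP; apply; first by exists (ulim G), (ulim_mono UG Gmono).
apply: ler_limP => e e0; have [l] := ds_inhab D.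
have [j _ [y _ [yp yY]]] := near e l e0.
by have := box_tri (dense_seq i) y Y; rewrite (box_sym y Y); lra.
Qed.

Definition basic (x : (nat * nat) + (nat * nat * nat)) (A : set mmX) : Prop :=
  match x with
  | inl (i, p) => hit i p A
  | inr (i, n, p) => miss i n p A
  end.

Lemma basic_net_open x : net_open [set A | basic x (proj1_sig A)].
Proof. by case: x => [[i p]|[[i n] p]]; [exact: hit_net_open|exact: miss_net_open]. Qed.

(** Finite intersections indexed by one integer: countability of the conditions makes these
    neighbourhoods a decreasing sequence. *)
Definition basic_nbhs (P : set mmX) (k : nat) (A : set mmX) : Prop :=
  forall x, (pickle x < k)%N -> basic x P -> basic x A.

Lemma basic_nbhs_net_open P k : net_open [set A | basic_nbhs P k (proj1_sig A)].
Proof.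
move=> D a A aA; elim: k => [|k ih] hA; first by apply: residually_all => l x.
have {}ih := ih (fun x xk => hA x (ltnW xk)).
have step : residually (fun l => forall x, pickle x = k -> basic x P -> basic x (proj1_sig (a l))).
  have [[x [xk xP]]|h] := pselect (exists x, pickle x = k /\ basic x P); last first.
    by apply: residually_all => l x xk xP; case: h; exists x.
  have xA : basic x (proj1_sig A) by apply: hA => //; rewrite xk.
  have := @basic_net_open x _ _ _ aA xA; apply: residually_imp => l xl y yk _.
  by rewrite (pcan_inj pickleK (etrans yk (esym xk))).
apply: residually_imp (residuallyI ih step) => l [h1 h2] x.
by rewrite ltnS leq_eqVlt => /predU1P[/h2|/h1].
Qed.

(** Hit conditions near a point of [P] give convergence of the distances to 0; for a point outside,
    one miss condition keeps the distances above a positive bound. *)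
Lemma basic_nbhs_weak_cvg (P : Pi) (Pn : nat -> Pi) :
  (forall k, basic_nbhs (proj1_sig P) k (proj1_sig (Pn k))) -> weak_cvg Pn P.
Proof.
move=> h.
have ev x : basic x (proj1_sig P) ->
    exists N : nat, forall k, (N <= k)%N -> basic x (proj1_sig (Pn k)).
  by move=> xP; exists (pickle x).+1 => k xk; exact: h.
have ne n : proj1_sig (Pn n) !=set0 by case: (Pn n) => S [].
split => A PA.
  apply/Rcvg_distP => e e0; have [p hp2] : exists p, 2 * halfpow p < e by apply: halfpow_lt => //; lra.
  have [i Ai] := dense_seqP A (halfpow_gt0 p).
  have [|N hN] := ev (inl (i, p)); first by exists A => //; rewrite box_sym.
  exists N => n /hN [y Py yi]; rewrite sub0r normrN ger0_norm; last exact: box_to_set_ge0.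
  apply: le_lt_trans (box_to_set_le A (ne n) Py) _.
  by have := box_tri A (dense_seq i) y; lra.
apply/limn_einf_gt0P.
have [e0 e00 he0] : exists2 e : Real, 0 < e & forall B, proj1_sig P B -> e <= box A B.
  apply: contrapT => H; apply: PA; apply: (@pyramid_box_closed P A) => e e0.
  apply: contrapT => H'; apply: H; exists e => // B PB; rewrite leNgt; apply/negP => AB.
  by apply: H'; exists B.
have [p hp2] : exists p, 2 * halfpow p < e0 by apply: halfpow_lt => //; lra.
have p2 : 0 < halfpow p / 2 by have := halfpow_gt0 p; lra.
have [i Ai] := dense_seqP A p2.
have [n [delta [d0 hd]]] := approx_by_cube_laws A p2.
have [|N hN] := ev (inr (i, n, p)).
  move=> y Py _; have := he0 y Py; have := box_tri A (dense_seq i) y.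
  by have := halfpow_gt0 p; lra.
exists delta, N; split => // k /hN hk; apply: box_to_set_ge => // B PB.
rewrite leNgt; apply/negP => /hd [Y [KY YB AY]].
(* Downward closure turns any element of [Pn k] near [A] into a cube law of [Pn k] near [A], which
   the miss condition forbids. *)
have PY : proj1_sig (Pn k) Y.
  by case: (Pn k) PB => S /= [_ [_ [down _]]] SB; exact: down YB.
have := hk Y PY KY; have := box_tri (dense_seq i) A Y; rewrite (box_sym _ A); lra.
Qed.

(** Otherwise, choosing for each [k] a pyramid of the [k]-th neighbourhood outside [U] gives a
    sequence that converges weakly to [P]. *)
Lemma weak_open_basic_nbhs (U : set Pi) (P : Pi) : weak_open U -> U P ->
  exists k, forall P' : Pi, basic_nbhs (proj1_sig P) k (proj1_sig P') -> U P'.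
Proof.
move=> oU UP; apply: contrapT => H.
have ex k : exists P' : Pi, basic_nbhs (proj1_sig P) k (proj1_sig P') /\ ~ U P'.
  apply: contrapT => H'; apply: H; exists k => P' hP'; apply: contrapT => nU.
  by apply: H'; exists P'.
pose Pn k := projT1 (cid (ex k)).
have PnP k : basic_nbhs (proj1_sig P) k (proj1_sig (Pn k)) /\ ~ U (Pn k).
  by rewrite /Pn; case: cid.
have cv : weak_cvg Pn P by apply: basic_nbhs_weak_cvg => k; case: (PnP k).
by have [N hN] := oU _ _ UP cv; case: (PnP N) => _; apply; exact: hN.
Qed.

Theorem theorem1p8 : top_embedding weak_open tauK_open pyr_incl.
Proof.
split.
  move=> [P hP] [Q hQ] h; apply: eq_exist.
  exact: (congr1 (fun A : FX => proj1_sig A) h).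
split; first exact: tauK_weak_open.
move=> U oU.
(* The union of all basic neighbourhoods, in the space of closed sets, whose pyramids all belong to
   [U]. *)
exists [set A | exists P k, [/\ U P,
  forall P' : Pi, basic_nbhs (proj1_sig P) k (proj1_sig P') -> U P' &
  basic_nbhs (proj1_sig P) k (proj1_sig A)]].
  apply: net_open_tauK => D a A aA [P [k [UP hk Ak]]].
  have := basic_nbhs_net_open aA Ak; apply: residually_imp => l hl.
  by exists P, k.
apply/seteqP; split => P /=.
  by move=> UP; have [k hk] := weak_open_basic_nbhs oU UP; exists P, k; split => // x.
by move=> [Q [k [_ hk]]]; exact: hk.
Qed.
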